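(* Let $G\in\mathcal{C}$, $N\unlhd G$, and let $(H,H,\vartheta)\in\mathcal{L}_N$ be of height $n$ with $i$-th node $(H_i,A_i,\vartheta_i)$, $1\le i\le n$. Let $K=\ker\vartheta$. Then (i) $\displaystyle \alpha_{(G,H,K)}=\frac{[\operatorname{Cen}_G(\varepsilon(H,K)):\operatorname{Cen}_{H_{n-1}}(\varepsilon(H,K))]}{\prod_{2\le i\le n-1}[\operatorname{Cen}_{H_{i-1}}(e(H_i,H,K)):H_i]}$; (ii) $\alpha_{(G,H,K)}=1$ if and only if $\operatorname{Cen}_{H_{i-1}}(e(H_i,H,K))=\operatorname{Cen}_{H_{i-1}}(\varepsilon(H,K))H_i$ for all $2\le i\le n-1$; (iii) if $(H,H,\vartheta)$ is good, then in (i) and (ii) the subgroup $\operatorname{Cen}_{H_{i-1}}(e(H_i,H,K))$ can be replaced by $N_{H_{i-1}}(\ker\vartheta_i)$ for all $2\le i\le n-1$.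
   Context: All groups are finite. $\mathcal{C}$ is the class of finite groups $G$ such that every subgroup and every quotient group of $G$ is either abelian or contains a non-central abelian normal subgroup. For a character $\psi$ of $H\le G$ and $x\in G$, $\psi^x(g)=\psi(xgx^{-1})$; $\psi^G$ the induced character; $1_N$ trivial character; $\operatorname{Cen}_G(a)$ the centralizer in $G$ of an element $a\in\mathbb{Q}G$ under conjugation. For $K\unlhd H\le M$: $\widehat{H}=\frac1{|H|}\sum_{h\in H}h$; $\varepsilon(H,K)=\widehat K$ if $H=K$, else $\prod(\widehat K-\widehat L)$ over all $L\unlhd H$ with $L/K$ a minimal normal subgroup of $H/K$; $e(M,H,K)$ is the sum of all distinct $M$-conjugates of $\varepsilon(H,K)$. A Shoda pair of $M$ is $(H,K)$ with $K\unlhd H\le M$, $H/K$ cyclic, and $g\in M$, $[H,g]\cap H\subseteq K$ imply $g\in H$; then there is a unique rational number $\alpha_{(M,H,K)}$ such that $\alpha_{(M,H,K)}e(M,H,K)$ is a primitive central idempotent of $\mathbb{Q}M$. Fix $N\unlhd G$. An $N$-linear character triple of $G$ is $(H,A,\vartheta)$ with $H\le G$, $A\unlhd H$, $\vartheta$ a linear character of $A$ invariant in $H$, and $\ker(\vartheta^G)=N$. For $B\unlhd M\le G$ and linear $\lambda$ of $B$, $\widetilde{\operatorname{Lin}}(M|\lambda)$ is the set of linear characters of $M$ whose restriction to $B$ contains $\lambda$ and whose induction to $G$ has kernel $N$. For each triple a normal subgroup $\mathcal{A}=\mathcal{A}_{(H,A,\vartheta)}$ of $H$ is fixed, of maximal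 order among normal subgroups of $H$ containing $\ker\vartheta$ with abelian quotient by $\ker\vartheta$. $\operatorname{Aut}(\mathbb{C}|\vartheta)\times H$ (field automorphisms of $\mathbb{C}$ fixing $\mathbb{Q}(\vartheta)$, times $H$) acts on $\widetilde{\operatorname{Lin}}(\mathcal{A}|\vartheta)$ by $(\sigma,h)\cdot\varphi=\sigma\circ\varphi^h$; fix orbit representatives $\mathfrak{Lin}(\mathcal{A}|\vartheta)$. If $H\ne A$, $Cl(H,A,\vartheta)=\{(I_H(\varphi),\mathcal{A},\varphi):\varphi\in\mathfrak{Lin}(\mathcal{A}|\vartheta)\}$, $I_H(\varphi)=\{h\in H:\varphi^h=\varphi\}$; if $H=A$ it is empty. $\mathcal{G}_N$ is the directed graph of $N$-linear triples reachable from $(G,N,1_N)$ with edges $(u,v)$ whenever $v\in Cl(u)$; each vertex is reached by a unique directed path from $(G,N,1_N)$. $\mathcal{L}_N$ is the set of vertices of $\mathcal{G}_N$ of the form $(H,H,\vartheta)$. For such a leaf with path $v_1=(G,N,1_N),\dots,v_n=(H,H,\vartheta)$, $n$ is its height and $v_i=(H_i,A_i,\vartheta_i)$ its $i$-th node. The leaf is good if for every $1<i\le n$ and $x\in N_{H_{i-1}}(\ker\vartheta_i)$ there is a field automorphism $\sigma$ of $\mathbb{C}$ with $(\vartheta^{H_i})^x=\sigma\circ\vartheta^{H_i}$. *)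

(* Defs.v *)
From HB Require Import structures.
From mathcomp Require Import all_boot all_order all_algebra all_fingroup all_solvable all_field all_character.
From Stdlib Require Import ClassicalEpsilon.
Set Implicit Arguments. Unset Strict Implicit. Unset Printing Implicit Defensive.
Import GRing.Theory Num.Theory.
Local Open Scope ring_scope.

Section Defs.
Variable gT : finGroupType.

(* Rational group algebra Q[gT]: functions gT -> rat; an element a
   stands for  sum_g a(g) g.  Q M (M <= gT) = those with support in M. *)
Local Notation QG := {ffun gT -> rat}.

Definition inQ (M : {set gT}) (a : QG) : bool := [forall g, (g \notin M) ==> (a g == 0%R)].

Definition mulQ (a b : QG) : QG := [ffun g => (\sum_(h : gT) a h * b (h^-1 * g)%g)%R].
Definition oneQ : QG := [ffun g => ((g == 1%g) : nat)%:R%R].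
Definition hatQ (A : {set gT}) : QG := [ffun g => if g \in A then (#|A|%:R)^-1%R else 0%R].
(* x a x^-1 *)
Definition conjQ (a : QG) (x : gT) : QG := [ffun g => a (g ^ x)%g].

Definition CenQ (M : {set gT}) (a : QG) : {set gT} :=
  [set x in M | conjQ a x == a].

Definition minnormal_over (H K L : {group gT}) : bool :=
  [&& K \subset L, (L <| H)%g & minnormal (L / K)%g (H / K)%g].

Definition epsQ (H K : {group gT}) : QG :=
  if H == K then hatQ K
  else foldr (fun (L : {group gT}) acc => mulQ (hatQ K - hatQ L)%R acc) oneQ
         (enum [set L : {group gT} | minnormal_over H K L]).

Definition eQ (M H K : {group gT}) : QG :=
  (\sum_(a <- undup [seq conjQ (epsQ H K) x | x <- enum M]) a)%R.

Definition central_idemQ (M : {set gT}) (a : QG) : Prop :=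
  [/\ inQ M a, mulQ a a = a & forall b, inQ M b -> mulQ a b = mulQ b a].

Definition prim_central_idemQ (M : {set gT}) (a : QG) : Prop :=
  [/\ central_idemQ M a, a <> 0%R &
      forall e1 e2, central_idemQ M e1 -> central_idemQ M e2 ->
        mulQ e1 e2 = 0%R -> a = (e1 + e2)%R -> e1 = 0%R \/ e2 = 0%R].

Definition alphaQ (M H K : {group gT}) : rat :=
  epsilon (inhabits 0%R) (fun r : rat => prim_central_idemQ M ([ffun g => r * eQ M H K g])%R).
End Defs.

Local Open Scope group_scope.

Definition has_noncentral_abelian_normal (hT : finGroupType) (S : {group hT}) : Prop :=
  exists A : {group hT}, [/\ A <| S, abelian A & ~~ (A \subset 'Z(S))].

Definition classC (gT : finGroupType) (G : {group gT}) : Prop :=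
  (forall S : {group gT}, S \subset G ->
     abelian S \/ has_noncentral_abelian_normal S) /\
  (forall M : {group gT}, M <| G ->
     abelian (G / M) \/ has_noncentral_abelian_normal (G / M)%G).

Record triple (gT : finGroupType) := Triple {
  tH : {group gT};
  tA : {group gT};
  tth : 'CF(tA) }.

Section Triples.
Variables (gT : finGroupType) (G N : {group gT}).
Local Open Scope group_scope.

(* theta^x (g) = theta (x g x^-1) = theta (g ^ x^-1) *)
Definition NLinTriple (t : triple gT) : Prop :=
  [/\ tH t \subset G, tA t <| tH t, tth t \is a linear_char,
      (forall h g, h \in tH t -> tth t (g ^ h^-1) = tth t g) &
      cfker ('Ind[G] (tth t)) = N].

(* Aut(C | theta) (restricted to the algebraic numbers, where all character
   values lie) : ring automorphisms of algC fixing every value of theta *)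
Definition fixes_values (B : {set gT}) (th : 'CF(B)) (u : {rmorphism algC -> algC}) : Prop :=
  forall g, u (th g) = th g.

Definition LinT (B M : {group gT}) (lam : 'CF(B)) (phi : 'CF(M)) : Prop :=
  [/\ phi \is a linear_char, '['Res[B] phi, lam] != 0%R & cfker ('Ind[G] phi) = N].

Definition same_orbit (t : triple gT) (M : {group gT}) (phi1 phi2 : 'CF(M)) : Prop :=
  exists u : {rmorphism algC -> algC}, fixes_values (tth t) u /\
  exists2 h, h \in tH t & forall g, phi2 g = u (phi1 (g ^ h^-1)).

(* Specification of the fixed choices: for every N-linear triple t,
   Asel t is the chosen \mathcal{A}_t and Rep t is the chosen set of orbit
   representatives \mathfrak{Lin}(\mathcal{A}_t | theta). *)
Definition choice_spec (Asel : triple gT -> {group gT})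
  (Rep : forall t : triple gT, seq 'CF(Asel t)) : Prop :=
  forall t : triple gT, NLinTriple t ->
  let K := cfker (tth t) in
  [/\ Asel t <| tH t, K \subset Asel t, abelian (Asel t / K) &
      (forall B : {group gT}, B <| tH t -> K \subset B -> abelian (B / K) ->
          #|B| <= #|Asel t|)%N] /\
  [/\ (forall phi, phi \in Rep t -> LinT (tth t) phi),
      (forall psi : 'CF(Asel t), LinT (tth t) psi ->
          exists2 phi, phi \in Rep t & same_orbit t phi psi) &
      (forall phi1 phi2, phi1 \in Rep t -> phi2 \in Rep t ->
          same_orbit t phi1 phi2 -> phi1 = phi2)].

Definition root_triple : triple gT := @Triple gT G N 1%R.

Definition child (Asel : triple gT -> {group gT}) (t : triple gT) (phi : 'CF(Asel t)) : triple gT :=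
  @Triple gT ('I_(tH t)[phi])%G (Asel t) phi.

Definition in_Cl (Asel : triple gT -> {group gT})
  (Rep : forall t : triple gT, seq 'CF(Asel t)) (t t' : triple gT) : Prop :=
  tH t != tA t /\ exists2 phi, phi \in Rep t & t' = child (Asel:=Asel) (t:=t) phi.

Definition graph_path (Asel : triple gT -> {group gT})
  (Rep : forall t : triple gT, seq 'CF(Asel t)) (p : seq (triple gT)) : Prop :=
  [/\ (0 < size p)%N, nth root_triple p 0 = root_triple &
      forall i, (i.+1 < size p)%N ->
        in_Cl Rep (nth root_triple p i) (nth root_triple p i.+1)].

(* i-th node, 1-based (node 0 is read as node 1) *)
Definition node (p : seq (triple gT)) (i : nat) : triple gT := nth root_triple p i.-1.

Definition leaf_path (Asel : triple gT -> {group gT})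
  (Rep : forall t : triple gT, seq 'CF(Asel t)) (p : seq (triple gT)) : Prop :=
  graph_path Rep p /\ tH (last root_triple p) = tA (last root_triple p).

Definition good_leaf (p : seq (triple gT)) : Prop :=
  let v := last root_triple p in
  forall i, (1 < i <= size p)%N ->
  forall x, x \in 'N_(tH (node p i.-1))(cfker (tth (node p i))) ->
  exists u : {rmorphism algC -> algC},
    forall g, ('Ind[tH (node p i)] (tth v)) (g ^ x^-1) = u (('Ind[tH (node p i)] (tth v)) g).
End Triples.

(* Main.v *)
(** Let [n = #|G|] and let Gal(Q(zeta_n)/Q), i.e. the units modulo [n], act on the
    characters of the subgroups of [G].  Write T(chi) for the sum of the conjugates of
    chi over this group and s(chi) for the order of the stabilizer of chi.  Then
    eps(H, K) is T(theta) / (|H| s(theta)), because linear characters with the same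
    kernel are conjugate; summing over M-conjugates, e(M, H, K) is a nonzero rational
    multiple of T(theta^M).  If theta^M is irreducible, comparison with the primitive
    central idempotent attached to T(theta^M) gives
      alpha_(M,H,K) = |Cen_M(eps)| s(theta) / (|H| s(theta^M)).
    Along the path, put chi_i = theta^(H_i) and C_i = Cen_(H_(i-1))(e(H_i, H, K)).  By
    Clifford theory at the inertia group H_i of theta_i in H_(i-1), the orbit of chi_i
    under the stabilizer of chi_(i-1) is its orbit under C_i, on which H_i is the
    stabilizer; hence |C_i| s(chi_i) = |H_i| s(chi_(i-1)), and the product telescopes.
    At i = n this reads |Cen_(H_(n-1))(eps)| s(theta) = |H| s(chi_(n-1)), so alpha is the
    quotient of the first and last terms of |Cen_(H_i)(eps)| / s(chi_i), 1 <= i <= n-1.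
    This sequence is nondecreasing, with equality at a step precisely under the
    condition in (ii).  On a good leaf C_i = N_(H_(i-1))(ker theta_i). *)

Require Import Defs.
From HB Require Import structures.
From mathcomp Require Import all_boot all_order all_algebra all_fingroup all_solvable all_field all_character.
From mathcomp Require Import ring zify.
From Stdlib Require Import ClassicalEpsilon.
Set Implicit Arguments. Unset Strict Implicit. Unset Printing Implicit Defensive.
Import Order.TTheory GRing.Theory Num.Theory.
Local Open Scope ring_scope.

(** * The Galois action on characters *)

Section GaloisAction.

Variable n : nat.
Hypothesis n_gt0 : (0 < n)%N.

Lemma coprime_unit_Zp (k : {unit 'Z_n}) : coprime (FinRing.uval k) n.
Proof.
have := valP k; rewrite /= -[X in X \is a _]natr_Zp; move: (nat_of_ord _) => x.
(* ['Z_1] is encoded as the integers modulo 2, so [n = 1] is treated apart; everything is coprime to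
   1. *)
case: (ltnP 1 n) => [n_gt1 | n_le1 _]; first by rewrite unitZpE // coprime_sym.
have -> : n = 1%N by apply/eqP; rewrite eqn_leq n_le1.
exact: coprimen1.
Qed.

(* The element of Gal(Q(zeta_n)/Q) raising n-th roots of unity to the power k. *)
Definition nu (k : {unit 'Z_n}) : {rmorphism algC -> algC} :=
  sval (Qn_aut_exists (coprime_unit_Zp k)).

Lemma nu_root k z : z ^+ n = 1 -> nu k z = z ^+ FinRing.uval k.
Proof. by rewrite /nu; case: Qn_aut_exists => u /= Hu /Hu. Qed.

(** [nu k] is some extension of a Galois automorphism to [algC], so its composition law is available
    only on n-th roots of unity and their sums. *)
Lemma nuM_root k l z : z ^+ n = 1 -> nu (k * l)%g z = nu k (nu l z).
Proof.
move=> zn; rewrite !nu_root // ?nu_root //; last by rewrite -exprM mulnC exprM zn expr1n.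
rewrite -exprM mulnC; case: (ltnP 1 n) => [n_gt1 | n_le1].
  rewrite -(expr_mod (FinRing.uval k * FinRing.uval l)%N zn) /=.
  by congr (z ^+ (_ %% _)); rewrite Zp_cast.
have n1 : n = 1%N by apply/eqP; rewrite eqn_leq n_le1.
by have -> : z = 1 by [rewrite -[z]expr1 -[X in _ ^+ X]n1]; rewrite !expr1n.
Qed.

Section Characters.

Variables (gT : finGroupType) (M : {group gT}).
Hypothesis Mn : (#|M| %| n)%N.

(** On the cyclic group generated by [g], [chi] is a sum of linear characters. Hence [nu] acts on
    characters as a group. *)
Lemma char_value_roots (chi : 'CF(M)) g : chi \is a character -> g \in M ->
  exists2 s : seq algC, chi g = \sum_(z <- s) z & {in s, forall z, z ^+ n = 1}.
Proof.
move=> Nchi Mg; have sgM : <[g]>%g \subset M by rewrite cycle_subG.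
have [r def_r] := char_sum_irr (cfRes_char <[g]>%G Nchi).
exists [seq 'chi_i g | i <- r].
  by rewrite big_map -(cfResE chi sgM (cycle_id g)) def_r sum_cfunE.
move=> _ /mapP[i _ ->].
have lin_i : 'chi[<[g]>%G]_i \is a linear_char by apply: irr_cyclic_lin; apply: cycle_cyclic.
have := lin_char_unity_root lin_i (cycle_id g).
by have /dvdnP[q ->] := dvdn_trans (order_dvdG Mg) Mn; rewrite mulnC exprM => ->; rewrite expr1n.
Qed.

Lemma cfAut_nuM (chi : 'CF(M)) k l : chi \is a character ->
  cfAut (nu (k * l)%g) chi = cfAut (nu k) (cfAut (nu l) chi).
Proof.
move=> Nchi; apply/cfun_inP=> g Mg; rewrite !cfunE.
have [s -> s1] := char_value_roots Nchi Mg.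
rewrite !rmorph_sum !big_seq; apply: eq_bigr => z /s1; exact: nuM_root.
Qed.

Lemma cfAut_nu1 (chi : 'CF(M)) : chi \is a character -> cfAut (nu 1%g) chi = chi.
Proof.
move=> Nchi; apply/cfun_inP=> g Mg; rewrite cfunE.
have [s -> s1] := char_value_roots Nchi Mg.
rewrite rmorph_sum !big_seq; apply: eq_bigr => z /s1 z1; rewrite nu_root //= ?expr1.
Qed.

End Characters.

(** An automorphism of [algC] sends a primitive n-th root of unity to a power of it with exponent
    coprime to n. The unit [k] depends on [u] alone, not on the group or the character. *)
Lemma rmorphism_nu (u : {rmorphism algC -> algC}) :
  exists k, forall (gT : finGroupType) (M : {group gT}) (chi : 'CF(M)),
    (#|M| %| n)%N -> chi \is a character -> cfAut u chi = cfAut (nu k) chi.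
Proof.
have [w prim_w] := C_prim_root_exists n_gt0.
have prim_uw : n.-primitive_root (u w) by rewrite fmorph_primitive_root.
have [i uw] := prim_rootP prim_w (prim_expr_order prim_uw).
have co_i : coprime i n.
  by rewrite uw prim_root_exp_coprime in prim_uw.
have [k kE] : exists k : {unit 'Z_n}, forall z : algC, z ^+ n = 1 -> nu k z = z ^+ i.
  case: (ltnP 1 n) => [n_gt1 | n_le1].
    have Ui : (i%:R : 'Z_n) \is a GRing.unit by rewrite unitZpE // coprime_sym.
    exists (FinRing.Unit Ui) => z zn; rewrite nu_root //=.
    by rewrite val_Zp_nat // expr_mod.
  have n1 : n = 1%N by apply/eqP; rewrite eqn_leq n_le1.
  exists 1%g => z zn; suffices -> : z = 1 by rewrite rmorph1 expr1n.
  by rewrite -[z]expr1 -[X in _ ^+ X]n1.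
exists k => gT M chi Mn Nchi; apply/cfun_inP=> g Mg; rewrite !cfunE.
have [s -> s1] := char_value_roots Mn Nchi Mg.
rewrite !rmorph_sum !big_seq; apply: eq_bigr => z /s1 zn; rewrite kE //.
have [j ->] := prim_rootP prim_w zn.
by rewrite rmorphXn uw -!exprM mulnC.
Qed.

(** Both are faithful characters of the cyclic group [M / cfker phi]. At a generator their values
    have the same order m, so one value is a power of the other with exponent coprime to m. *)
Lemma eq_cfker_lin_nu (gT : finGroupType) (M : {group gT}) (phi psi : 'CF(M)) :
    (#|M| %| n)%N -> phi \is a linear_char -> psi \is a linear_char ->
  cfker phi = cfker psi -> exists k, psi = cfAut (nu k) phi.
Proof.
move=> Mn lin_phi lin_psi eqK.
(* Linear characters have values of modulus 1, so the centre of [phi] is all of [M]; modulo the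
   kernel it is cyclic. *)
have sMZ : M \subset 'Z(phi)%CF.
  apply/subsetP=> g Mg; rewrite /cfcenter lin_charW // inE Mg /=.
  by rewrite normC_lin_char ?lin_char1 ?eqxx.
have /cyclicP[hb def_hb] := cyclicS (quotientS (cfker phi) sMZ) (cfcenter_cyclic phi).
have : hb \in (M / cfker phi)%g by rewrite def_hb cycle_id.
case/morphimP=> h nKh Mh def_h.
have genM g : g \in M -> exists j, exists2 c, c \in cfker phi & g = (h ^+ j * c)%g.
  move=> Mg; have nKg : g \in 'N(cfker phi)%g by apply: (subsetP (cfker_norm phi)).
  have : coset (cfker phi) g \in <[hb]>%g by rewrite -def_hb mem_quotient.
  case/cycleP=> j def_gj; exists j, (h ^- j * g)%g; last by rewrite mulKVg.
  rewrite -[cfker phi]ker_coset; apply/kerP; first by rewrite groupM ?groupV ?groupX.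
  by rewrite morphM ?groupV ?groupX // morphV ?groupX // morphX //= -def_h def_gj mulVg.
have lin_val (xi : 'CF(M)) j c : xi \is a linear_char -> c \in cfker xi ->
    xi (h ^+ j * c)%g = xi h ^+ j.
  move=> lin_xi Kc; have Mc := subsetP (cfker_sub xi) c Kc.
  by rewrite lin_charM ?groupX // (cfker1 Kc) lin_char1 // mulr1 lin_charX.
have ker_exp (xi : 'CF(M)) j : xi \is a linear_char ->
    (xi h ^+ j == 1) = (h ^+ j \in cfker xi)%g.
  by move=> lin_xi; rewrite cfkerEchar ?lin_charW // inE groupX // lin_char1 // lin_charX.
have phi_n : phi h ^+ n = 1.
  by have /dvdnP[q ->] := dvdn_trans (order_dvdG Mh) Mn; rewrite mulnC exprM lin_char_unity_root // expr1n.
have [m prim_m m_dv_n] := prim_order_exists n_gt0 phi_n.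
have m_gt0 := prim_order_gt0 prim_m.
have psi_m : psi h ^+ m = 1.
  by apply/eqP; rewrite ker_exp // -eqK -ker_exp // (prim_expr_order prim_m).
have [i def_i] := prim_rootP prim_m psi_m.
have co_i : coprime i m.
  have [d prim_d d_dv_m] := prim_order_exists m_gt0 psi_m.
  suffices dm : d = m by rewrite dm def_i prim_root_exp_coprime in prim_d.
  apply/eqP; rewrite eqn_dvd d_dv_m (prim_order_dvd prim_m) ker_exp // eqK -ker_exp //.
  by rewrite (prim_expr_order prim_d) eqxx.
(* [i] is coprime to [m] but perhaps not to [n]: it is realized by an automorphism of [algC], which
   is then converted into a unit modulo [n]. *)
have [u uE] := Qn_aut_exists co_i.
have [k kE] := rmorphism_nu u; exists k.
rewrite -kE ?lin_charW //; apply/cfun_inP=> g Mg; rewrite cfunE.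
have [j [c Kc ->]] := genM g Mg.
rewrite !lin_val -?eqK // rmorphXn uE ?(prim_expr_order prim_m) //.
by rewrite def_i.
Qed.

End GaloisAction.

(** * Galois traces and stabilizers of characters *)

Section GaloisTrace.

Variable n : nat.
Hypothesis n_gt0 : (0 < n)%N.
Local Notation nu := (nu n_gt0).

(** Summing over all units, not over distinct conjugates, makes the trace commute with induction,
    restriction and conjugation; by [card_gal_fiber] a conjugate is counted [gal_stab] times. *)
Definition gal_tr (gT : finGroupType) (M : {group gT}) (chi : 'CF(M)) : 'CF(M) :=
  \sum_(k : {unit 'Z_n}) cfAut (nu k) chi.

Definition gal_stab (gT : finGroupType) (M : {group gT}) (chi : 'CF(M)) : nat :=
  #|[set k : {unit 'Z_n} | cfAut (nu k) chi == chi]|.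

Lemma gal_tr_Ind (gT : finGroupType) (M L : {group gT}) (chi : 'CF(M)) :
  gal_tr ('Ind[L] chi) = 'Ind[L] (gal_tr chi).
Proof. by rewrite linear_sum; apply: eq_bigr => k _; rewrite cfAutInd. Qed.

Lemma gal_tr_Res (gT : finGroupType) (M L : {group gT}) (chi : 'CF(M)) :
  gal_tr ('Res[L] chi) = 'Res[L] (gal_tr chi).
Proof. by rewrite linear_sum; apply: eq_bigr => k _; rewrite cfAutRes. Qed.

Lemma gal_tr_conjg (gT : finGroupType) (M : {group gT}) (chi : 'CF(M)) x :
  gal_tr (chi ^ x)%CF = (gal_tr chi ^ x)%CF.
Proof. by rewrite linear_sum; apply: eq_bigr => k _; rewrite cfAutConjg. Qed.

Section OneGroup.

Variables (gT : finGroupType) (M : {group gT}).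
Hypothesis Mn : (#|M| %| n)%N.

Lemma gal_stab_gt0 (chi : 'CF(M)) : chi \is a character -> (0 < gal_stab chi)%N.
Proof.
by move=> Nchi; apply/card_gt0P; exists 1%g; rewrite inE (cfAut_nu1 n_gt0 Mn).
Qed.

Lemma card_gal_fiber (chi : 'CF(M)) k0 : chi \is a character ->
  #|[set k : {unit 'Z_n} | cfAut (nu k) chi == cfAut (nu k0) chi]| = gal_stab chi.
Proof.
move=> Nchi; rewrite /gal_stab -[RHS](card_imset _ (mulgI k0)); apply: eq_card => k.
rewrite [LHS]inE. apply/eqP/imsetP=> [eq_k | [l]].
  exists (k0^-1 * k)%g; last by rewrite mulKVg.
  rewrite inE (cfAut_nuM n_gt0 Mn) // eq_k -(cfAut_nuM n_gt0 Mn) // mulVg.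
  by rewrite (cfAut_nu1 n_gt0 Mn).
by rewrite inE => /eqP eq_l ->; rewrite (cfAut_nuM n_gt0 Mn) // eq_l.
Qed.

Lemma gal_tr_aut (chi : 'CF(M)) k : chi \is a character ->
  gal_tr (cfAut (nu k) chi) = gal_tr chi.
Proof.
move=> Nchi; rewrite [RHS](reindex_inj (mulIg k)); apply: eq_bigr => l _.
by rewrite (cfAut_nuM n_gt0 Mn).
Qed.

Lemma gal_tr_dot (chi : 'CF(M)) i : chi \in irr M ->
  '[gal_tr chi, 'chi_i] =
    (gal_stab chi)%:R *+ [exists k, 'chi_i == cfAut (nu k) chi].
Proof.
move=> irr_chi; have Nchi := irrWchar irr_chi.
rewrite cfdot_suml.
rewrite (eq_bigr (fun k => if cfAut (nu k) chi == 'chi_i then 1 else 0)) => [|k _].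
  case: existsP => [[k0 /eqP ->] | no_k].
    by rewrite -big_mkcond sumr_const -cardsE card_gal_fiber.
  by rewrite big1 // => k _; case: eqP => // eq_k; case: no_k; exists k; rewrite eq_k.
have /irrP[j ->] : cfAut (nu k) chi \in irr M by rewrite cfAut_irr.
by rewrite cfdot_irr (inj_eq irr_inj); case: (_ == _).
Qed.

(** The constituents of a trace are exactly the conjugates of the character, and [psi] occurs in its
    own trace. *)
Lemma gal_tr_inj (chi psi : 'CF(M)) : chi \in irr M -> psi \in irr M ->
  gal_tr chi = gal_tr psi -> exists k, psi = cfAut (nu k) chi.
Proof.
move=> irr_chi /[dup] /irrP[i ->] irr_i eqT.
suff: [exists k, 'chi_i == cfAut (nu k) chi] by case/existsP=> k /eqP ->; exists k.
have := gal_tr_dot i irr_i; rewrite -eqT gal_tr_dot //.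
have -> : [exists k, 'chi_i == cfAut (nu k) 'chi_i].
  by apply/existsP; exists 1%g; rewrite (cfAut_nu1 n_gt0 Mn) // irr_char.
case: [exists _, _] => // /esym/eqP; rewrite mulr0n mulr1n pnatr_eq0 => /eqP s0.
by have := gal_stab_gt0 (irr_char i); rewrite s0.
Qed.

Lemma gal_tr_char (chi : 'CF(M)) : chi \is a character -> gal_tr chi \is a character.
Proof. by move=> Nchi; apply: rpred_sum => k _; rewrite cfAut_char. Qed.

(** Galois conjugates share their kernel; conversely [chi] is a constituent of its trace. *)
Lemma cfker_gal_tr (chi : 'CF(M)) : chi \in irr M ->
  cfker (gal_tr chi) = cfker chi.
Proof.
move=> irr_chi; have Nchi := irrWchar irr_chi.
apply/eqP; rewrite eqEsubset; apply/andP; split; last first.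
  apply: subset_trans (cfker_sum _ _ _); rewrite subsetI cfker_sub.
  by apply/bigcapsP=> k _; rewrite cfker_aut.
have [i def_chi] := irrP irr_chi; rewrite [X in _ \subset cfker X]def_chi.
apply: cfker_constt; first exact: gal_tr_char.
rewrite irr_consttE gal_tr_dot // (_ : [exists k, _] = true).
  by rewrite mulr1n pnatr_eq0 -lt0n gal_stab_gt0.
by apply/existsP; exists 1%g; rewrite (cfAut_nu1 n_gt0 Mn) // def_chi.
Qed.

End OneGroup.
End GaloisTrace.

(** * Central idempotents in coordinates *)

Lemma ratr_algC_inj : injective (ratr : rat -> algC).
Proof. exact: fmorph_inj. Qed.

Section Coordinates.

Variables (gT : finGroupType) (M : {group gT}).
Implicit Types (A B : 'CF(M)) (a b : {ffun gT -> rat}) (i j : Iirr M).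

(* In these coordinates the class function 'chi_i 1 / |M| *: 'chi_i is the i-th primitive
   central idempotent; the usual inverse (or complex conjugation) is dropped, which only
   permutes the indices. *)
Definition idem_coord A i : algC := #|M|%:R / 'chi_i 1%g * '[A, 'chi_i].

Definition idem_sum (c : Iirr M -> algC) : 'CF(M) :=
  \sum_i (c i * ('chi_i 1%g / #|M|%:R)) *: 'chi_i.

Lemma idem_sum_coord c i : idem_coord (idem_sum c) i = c i.
Proof.
rewrite /idem_coord cfdot_suml (bigD1 i) //= big1 => [|j ne_ji].
  rewrite cfdotZl cfdot_irr eqxx mulr1 addr0 mulrC !mulrA divfK ?neq0CG //.
  by rewrite mulfK ?irr1_neq0.
by rewrite cfdotZl cfdot_irr (negPf ne_ji) mulr0.
Qed.

Lemma coord_idem_sum A : idem_sum (idem_coord A) = A.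
Proof.
rewrite [RHS]cfun_sum_cfdot; apply: eq_bigr => i _; congr (_ *: _).
by rewrite /idem_coord mulrC !mulrA divfK ?neq0CG // mulfV ?irr1_neq0 // mul1r.
Qed.

Lemma idem_coord_inj A B : idem_coord A =1 idem_coord B -> A = B.
Proof.
by move=> eqAB; rewrite -[A]coord_idem_sum -[B]coord_idem_sum; apply: eq_bigr => i _; rewrite eqAB.
Qed.

Lemma idem_coordD A B i : idem_coord (A + B) i = idem_coord A i + idem_coord B i.
Proof. by rewrite /idem_coord cfdotDl mulrDr. Qed.

Lemma idem_coordB A B i : idem_coord (A - B) i = idem_coord A i - idem_coord B i.
Proof. by rewrite /idem_coord cfdotBl mulrBr. Qed.

Lemma idem_coord0 i : idem_coord 0 i = 0.
Proof. by rewrite /idem_coord cfdot0l mulr0. Qed.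

(** Coordinatewise, because the primitive idempotents are orthogonal; [convolE] identifies this with
    the product of the group algebra. *)
Definition convol A B : 'CF(M) := idem_sum (fun i => idem_coord A i * idem_coord B i).

Lemma convol_irr i j g :
  \sum_h 'chi_i h * 'chi_j (h^-1 * g)%g = #|M|%:R * ((i == j)%:R * ('chi_i g / 'chi_i 1%g)).
Proof.
have := generalized_orthogonality_relation g j i.
rewrite eq_sym => /(canRL (mulVKf (neq0CG M))) orth.
have -> : (i == j)%:R * ('chi_i g / 'chi_i 1%g) = (i == j)%:R * ('chi_j g / 'chi_j 1%g).
  by case: eqP => [-> //|_]; rewrite !mul0r.
rewrite -orth (reindex_inj invg_inj) /= [RHS]big_mkcond /=.
apply: eq_bigr => h _; rewrite invgK mulrC; case: ifPn => // Mh.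
by rewrite (cfun0 'chi_i) ?groupV // mulr0.
Qed.

Lemma convolE A B g : convol A B g = \sum_h A h * B (h^-1 * g)%g.
Proof.
rewrite -[in RHS](coord_idem_sum A) -[in RHS](coord_idem_sum B).
transitivity (\sum_h \sum_i \sum_j
  (idem_coord A i * ('chi_i 1%g / #|M|%:R)) * (idem_coord B j * ('chi_j 1%g / #|M|%:R)) *
    ('chi_i h * 'chi_j (h^-1 * g)%g)); last first.
  apply: eq_bigr => h _; rewrite !sum_cfunE mulr_suml; apply: eq_bigr => i _.
  by rewrite mulr_sumr; apply: eq_bigr => j _; rewrite !cfunE mulrACA.
rewrite exchange_big sum_cfunE; apply: eq_bigr => i _ /=.
rewrite exchange_big (bigD1 i) //= [X in _ + X]big1 => [|j ne_ji].
  rewrite addr0 -mulr_sumr convol_irr eqxx mul1r !cfunE.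
  have M0 := neq0CG M; have i0 := irr1_neq0 i.
  by field; rewrite M0 i0.
by rewrite -mulr_sumr convol_irr eq_sym (negPf ne_ji) mul0r !mulr0.
Qed.

(** Links rational coefficients to class functions of [M]; the elements so represented are those of
    the centre of Q[M]. *)
Definition represents a A := forall g, ratr (a g) = A g :> algC.

Lemma represents_inj a b A : represents a A -> represents b A -> a = b.
Proof.
by move=> aA bA; apply/ffunP=> g; apply: ratr_algC_inj; rewrite aA bA.
Qed.

Lemma represents_inQ a A : represents a A -> inQ M a.
Proof.
move=> aA; apply/forallP=> g; apply/implyP=> M'g.
by apply/eqP/ratr_algC_inj; rewrite aA cfun0 // rmorph0.
Qed.

Lemma represents_mul a b A B : represents a A -> represents b B ->
  represents (mulQ a b) (convol A B).
Proof.
move=> aA bB g; rewrite ffunE rmorph_sum convolE.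
by apply: eq_bigr => h _; rewrite rmorphM /= aA bB.
Qed.

Lemma representsD a b A B : represents a A -> represents b B -> represents (a + b) (A + B).
Proof. by move=> aA bB g; rewrite ffunE cfunE rmorphD /= aA bB. Qed.

Lemma representsB a b A B : represents a A -> represents b B -> represents (a - b) (A - B).
Proof. by move=> aA bB g; rewrite !ffunE !cfunE rmorphB /= aA bB. Qed.

Lemma represents0 : represents 0 0.
Proof. by move=> g; rewrite ffunE cfunE rmorph0. Qed.

Lemma represents_exists a : inQ M a ->
  (forall g m, g \in M -> m \in M -> a (g ^ m)%g = a g) -> exists A, represents a A.
Proof.
move=> /forallP aM aJ; pose f (g : gT) : algC := ratr (a g).
have f_class : is_class_fun <<M>>%g [ffun g => f g].
  rewrite genGid; apply: intro_class_fun => [g m Mg Mm | g M'g]; rewrite /f.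
    by rewrite aJ.
  by have := aM g; rewrite M'g => /eqP->; rewrite rmorph0.
by exists (Cfun 0 f_class) => g; rewrite cfunElock.
Qed.

Lemma represents_central a A b : represents a A -> inQ M b -> mulQ a b = mulQ b a.
Proof.
move=> aA /forallP bM; apply/ffunP=> g; rewrite !ffunE.
(* With h replaced by g h^-1, the two sums differ only in [a] being taken at g h^-1 or at h^-1 g,
   which are conjugate under h; for h outside [M] the factor [b h] vanishes. *)
rewrite (reindex_inj (mulgI g)) (reindex_inj invg_inj) /=.
apply: eq_bigr => h _; rewrite mulrC invMg invgK mulgVK.
case: (boolP (h \in M)) => [Mh | M'h]; last first.
  by have := bM h; rewrite M'h => /eqP->; rewrite !mul0r.
congr (_ * _); apply: ratr_algC_inj; rewrite !aA.
by rewrite -(cfunJ A (h^-1 * g)%g (groupVr Mh)) /conjg invgK mulgA mulKVg.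
Qed.

Lemma central_idem_represented a : central_idemQ M a ->
  exists2 A, represents a A & forall i, idem_coord A i = 0 \/ idem_coord A i = 1.
Proof.
case=> aM aa aC; have [g m Mg Mm | A aA] := represents_exists aM.
  (* [d] is the group element [m] itself; commuting with it makes [a] invariant under conjugation by
     [m]. *)
  pose d := [ffun g => (g == m)%:R : rat].
  have dM : inQ M d.
    apply/forallP=> x; apply/implyP=> M'x; rewrite ffunE; case: (x =P m) => // def_x.
    by rewrite def_x Mm in M'x.
  have mulQd b x : mulQ d b x = b (m^-1 * x)%g.
    rewrite ffunE (bigD1 m) //= big1 => [|h /negPf ne_hm]; last by rewrite ffunE ne_hm mul0r.
    by rewrite ffunE eqxx mul1r addr0.
  have dmulQ b x : mulQ b d x = b (x * m^-1)%g.
    rewrite ffunE (bigD1 (x * m^-1)%g) //= big1 => [|h ne_h].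
      by rewrite ffunE invMg invgK mulgKV eqxx mulr1 addr0.
    rewrite ffunE; case: eqP => [def_m | _]; last by rewrite mulr0.
    by case/eqP: ne_h; rewrite -def_m invMg invgK mulKVg.
  by have := dmulQ a (g * m)%g; rewrite aC // mulQd mulgK /conjg mulgA => ->.
exists A => // i; have AA : convol A A = A.
  apply/cfunP=> g; have <- := represents_mul aA aA g; by rewrite aa aA.
have := congr1 (fun B => idem_coord B i) AA; rewrite /= idem_sum_coord => cc.
case: (eqVneq (idem_coord A i) 0) => [|c0]; [by left | right].
by apply: (mulfI c0); rewrite cc mulr1.
Qed.

Lemma represents_central_idem a A : represents a A ->
  (forall i, idem_coord A i = 0 \/ idem_coord A i = 1) -> central_idemQ M a.
Proof.
move=> aA c01; split=> [||b]; [exact: represents_inQ aA | | exact: represents_central aA].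
suff AA : convol A A = A by apply: (represents_inj _ aA); rewrite -AA; apply: represents_mul.
apply: idem_coord_inj => i; rewrite idem_sum_coord.
by case: (c01 i) => ->; rewrite ?mul0r ?mulr1.
Qed.

(** [A] has rational values, hence is fixed by [u]. In particular a coordinate that vanishes at one
    character vanishes on its whole Galois orbit. *)
Lemma idem_coord_aut a A (u : {rmorphism algC -> algC}) i j : represents a A ->
  'chi_j = cfAut u 'chi_i -> idem_coord A j = u (idem_coord A i).
Proof.
move=> aA def_j; have uA : cfAut u A = A.
  by apply/cfunP=> g; rewrite cfunE -aA fmorph_rat.
by rewrite /idem_coord def_j -{1}uA cfdot_aut_irr cfunE [RHS]rmorphM /= fmorph_div /= rmorph_nat.
Qed.

End Coordinates.

(** * The element epsilon(H, K) in idempotent coordinates *)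

Section Epsilon.

Variables (gT : finGroupType) (H : {group gT}).
Implicit Types (L K : {group gT}) (i : Iirr H).

(** If [L] is not in the kernel, the trivial character does not occur in the restriction to the
    normal subgroup [L], so the sum is an inner product equal to 0. *)
Lemma sum_irr_normal L i : (L <| H)%g ->
  \sum_(g in L) ('chi_i g)^* = if L \subset cfker 'chi_i then #|L|%:R * 'chi_i 1%g else 0.
Proof.
move=> nLH; have sLH := normal_sub nLH.
case: ifPn => [kL | not_kL].
  rewrite (eq_bigr (fun=> 'chi_i 1%g)) => [|g Lg]; first by rewrite sumr_const mulr_natl.
  by rewrite (cfker1 (subsetP kL g Lg)) irr1_degree rmorph_nat.
have : '[1, 'Res[L] 'chi_i] = 0.
  rewrite cfdotC; apply/eqP; rewrite fmorph_eq0 -irr0; apply: contraNT not_kL => ne0.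
  by apply: constt0_Res_cfker => //; rewrite irr_consttE.
rewrite cfdotE => /eqP; rewrite mulf_eq0 invr_eq0 (negPf (neq0CG L)) /= => /eqP sum0.
rewrite -[RHS]sum0.
by apply: eq_bigr => g Lg; rewrite cfun1E Lg mul1r cfResE.
Qed.

Lemma represents_hatQ L : (L <| H)%g ->
  exists2 A : 'CF(H), represents (hatQ L) A &
    forall i, idem_coord A i = (L \subset cfker 'chi_i)%:R.
Proof.
move=> nLH; have /andP[sLH nLH'] := nLH.
have L0 : #|L|%:R != 0 :> algC := neq0CG L.
have [||A hA] := @represents_exists _ H (hatQ L).
- apply/forallP=> g; apply/implyP=> H'g; rewrite ffunE; case: ifP => // Lg.
  by rewrite (subsetP sLH) in H'g.
- by move=> g m _ Hm; rewrite !ffunE memJ_norm // (subsetP nLH').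
exists A => // i; rewrite /idem_coord cfdotE.
have -> : \sum_(g in H) A g * ('chi_i g)^* = #|L|%:R^-1 * \sum_(g in L) ('chi_i g)^*.
  rewrite mulr_sumr [LHS](big_setID L) /= (setIidPr sLH) [X in _ + X]big1 => [|g].
    by rewrite addr0; apply: eq_bigr => g Lg; rewrite -hA ffunE Lg fmorphV rmorph_nat.
  by rewrite inE -hA ffunE => /andP[/negPf-> _]; rewrite rmorph0 mul0r.
rewrite sum_irr_normal //; case: ifP => _; last by rewrite !mulr0.
by have H0 := neq0CG H; have i0 := irr1_neq0 i; rewrite mulr1n; field; rewrite L0 H0 i0.
Qed.

Lemma represents_oneQ : exists2 A : 'CF(H), represents (oneQ gT) A & forall i, idem_coord A i = 1.
Proof.
exists (#|H|%:R^-1 *: cfReg H) => [g | i].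
  rewrite ffunE cfunE cfRegE; case: eqP => _; rewrite /= ?rmorph0 ?mulr0 //.
  by rewrite mulr1n mulVf ?rmorph1 ?neq0CG.
rewrite /idem_coord cfdotZl cfReg_sum cfdot_suml (bigD1 i) //= big1 => [|j ne_ji].
  rewrite cfdotZl cfdot_irr eqxx mulr1 addr0.
  by have H0 := neq0CG H; have i0 := irr1_neq0 i; field; rewrite H0 i0.
by rewrite cfdotZl cfdot_irr (negPf ne_ji) mulr0.
Qed.

Lemma represents_prod_hatQ K (s : seq {group gT}) :
    (K <| H)%g -> {in s, forall L, L <| H}%g ->
  exists2 A : 'CF(H),
    represents (foldr (fun L acc => mulQ (hatQ K - hatQ L) acc) (oneQ gT) s) A &
    forall i, idem_coord A i =
      \prod_(L <- s) ((K \subset cfker 'chi_i)%:R - (L \subset cfker 'chi_i)%:R).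
Proof.
move=> nKH; elim: s => [|L s IHs] nsH /=.
  by have [A hA cA] := represents_oneQ; exists A => // i; rewrite cA big_nil.
have [|A hA cA] := IHs; first by move=> L1 sL1; apply: nsH; rewrite inE sL1 orbT.
have [B hB cB] := represents_hatQ nKH.
have [C hC cC] := represents_hatQ (nsH L (mem_head _ _)).
exists (convol (B - C) A); first by apply: represents_mul; first exact: representsB.
by move=> i; rewrite idem_sum_coord idem_coordB cA cB cC big_cons.
Qed.

Lemma minnormal_over_exists K L : (K <| H)%g -> (L <| H)%g -> K \proper L ->
  exists2 L1 : {group gT}, minnormal_over H K L1 & L1 \subset L.
Proof.
move=> nKH nLH /andP[sKL not_sLK].
have nKL := normalS sKL (normal_sub nLH) nKH.
have [||Mb minM sML] := @minnormal_exists _ (H / K)%G (L / K)%G.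
- by rewrite -subG1 quotient_sub1 ?normal_norm.
- exact: quotient_norms (normal_norm nLH).
have nMH : (Mb <| H / K)%g.
  have /mingroupP[/andP[_ nM] _] := minM.
  by rewrite /normal nM (subset_trans sML) // quotientS // normal_sub.
have [L1 def_M sKL1 nL1H] := inv_quotientN nKH nMH.
exists L1; first by rewrite /minnormal_over sKL1 nL1H -def_M.
rewrite def_M quotientSGK // in sML.
exact: subset_trans (normal_sub nL1H) (normal_norm nKH).
Qed.

(** The factor for [L] has coordinate 1 at characters whose kernel contains [K] but not [L], and 0
    elsewhere; a kernel containing [K] and no minimal [L] is [K] itself. *)
Lemma represents_epsQ K : (K <| H)%g ->
  exists2 A : 'CF(H), represents (epsQ H K) A &
    forall i, idem_coord A i = (cfker 'chi_i == K)%:R.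
Proof.
move=> nKH; rewrite /epsQ; case: ifPn => [/eqP eqHK | neqHK].
  have [A hA cA] := represents_hatQ nKH; exists A => // i.
  by rewrite cA eqEsubset -[in cfker _ \subset K]eqHK cfker_sub.
set s := enum _; have sP L : L \in s -> minnormal_over H K L by rewrite mem_enum inE.
have [L /sP/and3P[] // | A hA cA] := @represents_prod_hatQ K s nKH.
exists A => // i; rewrite cA; case: eqP => [def_K | neqK].
  rewrite big_seq big1 // => L /sP/and3P[sKL _ /mingroupP[/andP[ntL _] _]].
  rewrite def_K subxx (negPf (_ : ~~ (L \subset K))) ?subr0 //.
  by apply: contra ntL => sLK; apply/eqP/trivgP; rewrite quotient_sub1 // (subset_trans sLK) ?normG.
(* A single vanishing factor is enough. If the kernel is larger than [K], take a minimal [L] inside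
   it; if it does not contain [K], any [L] works, and one exists since [H] differs from [K]. *)
suffices [L sL ->] : exists2 L, L \in s &
    (K \subset cfker 'chi_i) = (L \subset cfker 'chi_i).
  by rewrite (big_rem L) //= subrr mul0r.
case: (boolP (K \subset cfker 'chi_i)) => [sKi | not_sKi].
  have [||L minL sLi] := @minnormal_over_exists K (cfker 'chi_i)%G nKH; first exact: cfker_normal.
    by rewrite properEneq sKi andbT; apply/eqP=> eqKi; apply: neqK; rewrite eqKi.
  by exists L; rewrite ?mem_enum ?inE.
have [|L minL _] := @minnormal_over_exists K H nKH (normal_refl H).
  by rewrite properEneq normal_sub // andbT eq_sym; apply: contra neqHK => /eqP/val_inj->.
exists L; rewrite ?mem_enum ?inE //; apply/esym/negP=> sLi; case/negP: not_sKi.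
by case/and3P: minL => sKL _ _; apply: subset_trans sLi.
Qed.

End Epsilon.

(** * Primitive central idempotents and Galois orbits *)

Section Primitive.

Variable n : nat.
Hypothesis n_gt0 : (0 < n)%N.
Local Notation nu := (nu n_gt0).
Local Notation gal_tr := (gal_tr n_gt0).
Local Notation gal_stab := (gal_stab n_gt0).
Variables (gT : finGroupType) (M : {group gT}).
Hypothesis Mn : (#|M| %| n)%N.

(** The usual idempotent of Q[M] attached to [chi], summed over distinct conjugates. Omitting the
    inverse is harmless, as complex conjugation preserves the Galois orbit. *)
Definition gal_idem (chi : 'CF(M)) : 'CF(M) :=
  (chi 1%g / #|M|%:R / (gal_stab chi)%:R) *: gal_tr chi.

Lemma gal_idem_coord chi i : chi \in irr M ->
  idem_coord (gal_idem chi) i = [exists k, 'chi_i == cfAut (nu k) chi]%:R.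
Proof.
move=> irr_chi; have Nchi := irrWchar irr_chi.
rewrite /idem_coord cfdotZl gal_tr_dot //.
case: existsP => [[k /eqP def_i] | _]; last by rewrite mulr0n !mulr0.
have s0 : (gal_stab chi)%:R != 0 :> algC by rewrite pnatr_eq0 -lt0n gal_stab_gt0.
have chi_i1 : 'chi_i 1%g = chi 1%g by rewrite def_i cfAut_char1.
have i0 := irr1_neq0 i; have M0 := neq0CG M.
by rewrite -chi_i1 !mulr1n; field; rewrite s0 M0 i0.
Qed.

(** A decomposition splits the orbit of [chi] into two disjoint parts, each Galois stable by
    rationality. The part that misses [chi] is therefore empty. *)
Lemma gal_idem_prim a chi : chi \in irr M -> represents a (gal_idem chi) ->
  prim_central_idemQ M a.
Proof.
move=> irr_chi ha; have Nchi := irrWchar irr_chi.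
have chi_orb k i : 'chi_i = cfAut (nu k) chi -> [exists k, 'chi_i == cfAut (nu k) chi].
  by move=> def_i; apply/existsP; exists k; rewrite def_i.
have [i0 def_chi] := irrP irr_chi.
have orb0 : 'chi_i0 = cfAut (nu 1%g) chi by rewrite (cfAut_nu1 n_gt0 Mn).
split.
- apply: represents_central_idem ha _ => i; rewrite gal_idem_coord //.
  by case: [exists _, _]; [right | left].
- move=> a0; have := gal_idem_coord i0 irr_chi; rewrite (chi_orb 1%g) //.
  suffices ->: gal_idem chi = 0 by rewrite idem_coord0 => /esym/eqP; rewrite oner_eq0.
  by apply/cfunP=> g; rewrite -ha a0 ffunE cfunE rmorph0.
move=> e1 e2 /central_idem_represented[A hA cA] /central_idem_represented[B hB cB] e12 def_a.
have AB0 i : idem_coord A i * idem_coord B i = 0.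
  rewrite -[LHS](idem_sum_coord (fun i => idem_coord A i * idem_coord B i)) -[RHS](idem_coord0 i).
  congr (idem_coord _ i); apply/cfunP=> g.
  by rewrite -(represents_mul hA hB) e12 ffunE cfunE rmorph0.
have sumAB i : idem_coord A i + idem_coord B i = [exists k, 'chi_i == cfAut (nu k) chi]%:R.
  rewrite -gal_idem_coord // -idem_coordD; congr (idem_coord _ i); apply/cfunP=> g.
  by rewrite -(representsD hA hB) -def_a.
have all0 e (C D : 'CF(M)) : represents e C -> idem_coord C i0 = 0 ->
    (forall i, idem_coord C i = 0 \/ idem_coord C i = 1) ->
    (forall i, idem_coord D i = 0 \/ idem_coord D i = 1) ->
    (forall i, idem_coord C i + idem_coord D i = [exists k, 'chi_i == cfAut (nu k) chi]%:R) ->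
  e = 0.
  move=> hC Ci0 cC cD sumCD; apply: (represents_inj hC).
  suffices -> : C = 0 by apply: represents0.
  apply: idem_coord_inj => i; rewrite idem_coord0.
  have := sumCD i; case: existsP => [[k /eqP def_i] _ | _ /=].
    by rewrite def_chi in def_i; rewrite (idem_coord_aut hC def_i) Ci0 rmorph0.
  case: (cC i) => // ->; case: (cD i) => -> /eqP; first by rewrite addr0 oner_eq0.
  by rewrite -(natrD _ 1 1) pnatr_eq0.
have /eqP := AB0 i0; rewrite mulf_eq0 => /orP[]/eqP c0; [left | right].
  exact: all0 hA c0 cA cB sumAB.
by apply: all0 hB c0 cB cA _ => i; rewrite addrC.
Qed.

(** An irreducible character with the same kernel as [th] is linear, the kernel containing the
    derived group, and hence is a Galois conjugate of [th]. *)
Lemma epsQ_gal_tr (th : 'CF(M)) : th \is a linear_char ->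
  represents (epsQ M (cfker th)%G) ((#|M|%:R * (gal_stab th)%:R)^-1 *: gal_tr th).
Proof.
move=> lin_th; have irr_th := lin_char_irr lin_th.
have [A hA cA] := represents_epsQ (cfker_normal th).
suffices <- : A = (#|M|%:R * (gal_stab th)%:R)^-1 *: gal_tr th by [].
have -> : (#|M|%:R * (gal_stab th)%:R)^-1 *: gal_tr th = gal_idem th.
  by rewrite /gal_idem lin_char1 // mul1r invfM.
apply: idem_coord_inj => i; rewrite cA gal_idem_coord //; congr (_%:R); congr nat_of_bool.
apply/eqP/existsP=> [/= eqK | [k /eqP ->]]; last by rewrite cfker_aut.
have lin_i : 'chi_i \is a linear_char by rewrite lin_irr_der1 eqK lin_char_der1.
have [k ->] := eq_cfker_lin_nu n_gt0 Mn lin_th lin_i (esym eqK).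
by exists k.
Qed.

End Primitive.

(** * The idempotents of a Shoda pair *)

Section Conjugation.

Variable gT : finGroupType.
Implicit Types (a : {ffun gT -> rat}) (M H L : {group gT}).

Lemma conjQM a x y : conjQ (conjQ a x) y = conjQ a (y * x)%g.
Proof. by apply/ffunP=> g; rewrite !ffunE conjgM. Qed.

Lemma conjQ1 a : conjQ a 1%g = a.
Proof. by apply/ffunP=> g; rewrite ffunE conjg1. Qed.

Lemma CenQ_group_set M a : group_set (CenQ M a).
Proof.
apply/group_setP; split=> [|x y]; first by rewrite inE group1 conjQ1 eqxx.
rewrite !inE => /andP[Mx /eqP ax] /andP[My /eqP ay].
by rewrite groupM // -conjQM ay ax eqxx.
Qed.

Canonical CenQ_group M a := Group (CenQ_group_set M a).

Lemma card_CenQ_fiber M a x0 : x0 \in M ->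
  #|[set x in M | conjQ a x == conjQ a x0]| = #|CenQ M a|.
Proof.
move=> Mx0; rewrite -[RHS](card_imset _ (mulgI x0)); apply: eq_card => x.
rewrite [LHS]inE; apply/andP/imsetP=> [[Mx /eqP eq_x] | [y]].
  exists (x0^-1 * x)%g; last by rewrite mulKVg.
  by rewrite inE groupM ?groupV // -conjQM eq_x conjQM mulVg conjQ1 eqxx.
by rewrite inE => /andP[My /eqP ay] ->; rewrite groupM // -conjQM ay.
Qed.

(** Each distinct conjugate arises from one coset of the centralizer, so its multiplicity in the
    list of all conjugates is the order of the centralizer. *)
Lemma sum_conjQ_eQ M H (K : {group gT}) g :
  \sum_(x in M) epsQ H K (g ^ x)%g = #|CenQ M (epsQ H K)|%:R * eQ M H K g.
Proof.
set eps := epsQ H K; pose s := [seq conjQ eps x | x <- enum M].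
transitivity (\sum_(a <- s) a g).
  by rewrite big_map big_enum; apply: eq_bigr => x _; rewrite ffunE.
rewrite -big_undup_iterop_count /eQ sum_ffunE mulr_sumr !big_seq.
apply: eq_bigr => a; rewrite mem_undup => /mapP[x0]; rewrite mem_enum => Mx0 def_a.
rewrite -(card_CenQ_fiber eps Mx0) -def_a mulr_natl; congr (_ *+ _).
rewrite count_map cardE -size_filter /enum_mem -filter_predI; congr (size _).
by apply: eq_filter => x; rewrite /= inE andbC.
Qed.

(** Invariance is stated pointwise because [(A ^ x)%CF] defaults to [A] when [x] does not normalize
    [M]. *)
Definition inv_conj M (A : 'CF(M)) (X : {set gT}) : {set gT} :=
  [set x in X | [forall g, A (g ^ x)%g == A g]].

Lemma CenQ_represents M (A : 'CF(M)) (X : {set gT}) a c :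
  represents a (c *: A) -> c != 0 -> CenQ X a = inv_conj A X.
Proof.
move=> hA nz_c; apply/setP=> x; rewrite !inE; congr (_ && _); apply/eqP/forallP=> [ax g | Ax].
  apply/eqP/(mulfI nz_c); have := hA (g ^ x)%g; have := hA g.
  by rewrite !cfunE => <- <-; rewrite -{2}ax ffunE.
apply/ffunP=> g; rewrite ffunE; apply: ratr_algC_inj; rewrite !hA !cfunE.
by rewrite (eqP (Ax g)).
Qed.

(** [alphaQ] selects a scalar by [epsilon], so computing it requires uniqueness. Idempotency
    determines the scalar at any point where [a] does not vanish. *)
Lemma prim_central_idemQ_scale_inj M a r r' :
    prim_central_idemQ M [ffun g => r * a g] -> prim_central_idemQ M [ffun g => r' * a g] ->
  r = r'.
Proof.
have sq t g : mulQ [ffun g => t * a g] [ffun g => t * a g] g = t ^+ 2 * mulQ a a g.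
  by rewrite !ffunE mulr_sumr; apply: eq_bigr => h _; rewrite !ffunE expr2 mulrACA.
case=> [[_ idr _] nzr _] [[_ idr' _] nzr' _].
have nz t : [ffun g => t * a g] <> 0 -> t != 0.
  by move=> nzt; apply/eqP=> t0; case: nzt; apply/ffunP=> g; rewrite !ffunE t0 mul0r.
have [g nz_g] : exists g, a g != 0.
  apply/existsP; apply: contra_notT nzr => /existsPn a0; apply/ffunP=> g.
  by have := a0 g; rewrite negbK !ffunE => /eqP->; rewrite mulr0.
have := congr1 (fun f : {ffun gT -> rat} => f g) idr; rewrite /= sq [RHS]ffunE => eq_r.
have := congr1 (fun f : {ffun gT -> rat} => f g) idr'; rewrite /= sq [RHS]ffunE => eq_r'.
have eq1 : r * mulQ a a g = a g by apply: (mulfI (nz _ nzr)); rewrite mulrA -expr2 eq_r.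
have eq2 : r' * mulQ a a g = a g by apply: (mulfI (nz _ nzr')); rewrite mulrA -expr2 eq_r'.
have nz_aa : mulQ a a g != 0 by apply: contraNneq nz_g => aa0; rewrite -eq1 aa0 mulr0.
by apply: (mulIf nz_aa); rewrite eq1 eq2.
Qed.

End Conjugation.

(** * The rational number alpha in terms of Galois stabilizers *)

Section Alpha.

Variable n : nat.
Hypothesis n_gt0 : (0 < n)%N.
Local Notation nu := (nu n_gt0).
Local Notation gal_tr := (gal_tr n_gt0).
Local Notation gal_stab := (gal_stab n_gt0).
Variables (gT : finGroupType) (H : {group gT}) (th : 'CF(H)).
Hypotheses (Hn : (#|H| %| n)%N) (lin_th : th \is a linear_char).
Let K : {group gT} := (cfker th)%G.

Let stab_neq0 (L : {group gT}) (chi : 'CF(L)) : (#|L| %| n)%N -> chi \is a character ->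
  (gal_stab chi)%:R != 0 :> algC.
Proof. by move=> Ln Nchi; rewrite pnatr_eq0 -lt0n gal_stab_gt0. Qed.

(** Summing the trace of [th] over all conjugations by [M] is, up to a scalar, inducing it to
    [M]. *)
Lemma eQ_gal_tr (M : {group gT}) : H \subset M ->
  represents (eQ M H K)
    (((gal_stab th)%:R * #|CenQ M (epsQ H K)|%:R)^-1 *: gal_tr ('Ind[M] th)).
Proof.
move=> sHM g; have s0 := stab_neq0 Hn (lin_charW lin_th).
have C0 := neq0CG (CenQ_group M (epsQ H K)); rewrite /= in C0.
have H0 := neq0CG H.
apply: (mulfI C0); rewrite -[X in X * _](rmorph_nat (ratr : {rmorphism rat -> algC})) -rmorphM.
rewrite /= -sum_conjQ_eQ rmorph_sum cfunE gal_tr_Ind cfIndE //.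
rewrite (eq_bigr (fun x => (#|H|%:R * (gal_stab th)%:R)^-1 * gal_tr th (g ^ x)%g)) => [|x _].
  by rewrite -mulr_sumr; field; rewrite C0 s0 H0.
by rewrite /= (epsQ_gal_tr n_gt0 Hn lin_th) cfunE.
Qed.

Lemma CenQ_epsQ (X : {set gT}) : CenQ X (epsQ H K) = inv_conj (gal_tr th) X.
Proof.
apply: CenQ_represents (epsQ_gal_tr n_gt0 Hn lin_th) _.
by rewrite invr_eq0 mulf_neq0 ?neq0CG // stab_neq0 ?lin_charW.
Qed.

Lemma CenQ_eQ (M : {group gT}) (X : {set gT}) : H \subset M ->
  CenQ X (eQ M H K) = inv_conj (gal_tr ('Ind[M] th)) X.
Proof.
move=> sHM; apply: CenQ_represents (eQ_gal_tr sHM) _.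
by rewrite invr_eq0 mulf_neq0 ?(neq0CG (CenQ_group _ _)) // stab_neq0 ?lin_charW.
Qed.

(** The induced character has degree [M : H], so its trace has coefficient 1 / (|H| s) in
    [gal_idem], with s its stabilizer order; alpha is the quotient by the coefficient in
    [eQ_gal_tr]. *)
Lemma alphaQ_gal_stab (M : {group gT}) :
    H \subset M -> (#|M| %| n)%N -> 'Ind[M] th \in irr M ->
  alphaQ M H K = (#|CenQ M (epsQ H K)| * gal_stab th)%N%:R /
                 (#|H| * gal_stab ('Ind[M] th))%N%:R :> rat.
Proof.
move=> sHM Mn irr_chi; set r0 := RHS.
have prim0 : prim_central_idemQ M [ffun g => r0 * eQ M H K g].
  apply: (gal_idem_prim Mn irr_chi) => g.
  rewrite ffunE rmorphM /= (eQ_gal_tr sHM) /gal_idem !cfunE /r0 rmorphM /= fmorphV !rmorph_nat.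
  rewrite cfInd1 // lin_char1 // mulr1 -(Lagrange sHM).
  have s0 := stab_neq0 Hn (lin_charW lin_th); have s1 := stab_neq0 Mn (irrWchar irr_chi).
  have H0 := neq0CG H; have C0 := neq0CG (CenQ_group M (epsQ H K)); rewrite /= in C0.
  have MH0 : #|M : H|%g%:R != 0 :> algC by rewrite pnatr_eq0 -lt0n.
  rewrite !natrM; field.
  by rewrite s0 s1 H0 C0 MH0.
apply: (prim_central_idemQ_scale_inj _ prim0).
exact: (epsilon_spec (inhabits (0 : rat))
  (fun r => prim_central_idemQ M [ffun g => r * eQ M H K g]) (ex_intro _ r0 prim0)).
Qed.

End Alpha.

(** * One Clifford step *)

Section Clifford.

Variables (gT : finGroupType) (L A I : {group gT}) (phi : 'CF(A)).
Hypotheses (nAL : (A <| L)%g) (irr_phi : phi \in irr A) (defI : I = 'I_L[phi]%g :> {set gT}).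

Lemma inertia_Ind_irr (chi : 'CF(I)) :
  chi \in irr I -> '['Res[A] chi, phi] != 0 -> 'Ind[L] chi \in irr L.
Proof.
have eqI : I = 'I_L[phi]%G by apply: val_inj.
case/irrP: irr_phi => t def_phi; subst I phi => /irrP[s ->] over.
have [Ind_irr _ _ _ _] := constt_Inertia_bijection t nAL.
by apply: Ind_irr; rewrite constt_Ind_Res irr_consttE.
Qed.

(** Injectivity in the Clifford correspondence. [I] is tied to the inertia group only by an equality
    of sets, so that [phi] may be replaced by a conjugate with the same inertia group. *)
Lemma inertia_Ind_inj (chi1 chi2 : 'CF(I)) :
    chi1 \in irr I -> '['Res[A] chi1, phi] != 0 ->
    chi2 \in irr I -> '['Res[A] chi2, phi] != 0 ->
  'Ind[L] chi1 = 'Ind[L] chi2 -> chi1 = chi2.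
Proof.
have eqI : I = 'I_L[phi]%G by apply: val_inj.
case/irrP: irr_phi => t def_phi; subst I phi => /irrP[s1 ->] over1 /irrP[s2 ->] over2 eqInd.
have [Ind_irr Ind_inj _ _ _] := constt_Inertia_bijection t nAL.
by congr 'chi_ _; apply: Ind_inj; rewrite ?constt_Ind_Res ?irr_consttE // /Ind_Iirr eqInd.
Qed.

End Clifford.

(** By Clifford, the restriction is a multiple of the sum of the L-class of [phi1], which is
    orthogonal to irreducible characters outside that class. *)
Lemma constt_Res_cfclass (gT : finGroupType) (L A : {group gT}) (psi : 'CF(L)) (phi1 phi2 : 'CF(A)) :
    (A <| L)%g -> psi \in irr L -> phi1 \in irr A -> phi2 \in irr A ->
    '['Res[A] psi, phi1] != 0 -> '['Res[A] psi, phi2] != 0 ->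
  exists2 x, x \in L & phi2 = (phi1 ^ x)%CF.
Proof.
move=> nAL /irrP[i ->] /irrP[j ->] /irrP[l ->] over1 over2.
apply/cfclassP; rewrite -irr_consttE in over1.
apply/negPn/negP=> not_cl; case/eqP: over2; rewrite (Clifford_Res_sum_cfclass nAL over1) cfdotZl cfdot_suml.
rewrite big1_seq ?mulr0 // => xi /andP[_ cl_xi].
have /cfclassP[y Ly def_xi] := cl_xi; rewrite def_xi -conjg_IirrE cfdot_irr.
suff /negPf-> : conjg_Iirr j y != l by []; apply: contraNneq not_cl => <-; rewrite conjg_IirrE.
by apply/cfclassP; exists y.
Qed.

(** [J] fixes [phi], so all terms of the induction formula on [A] are equal. *)
Lemma cfRes_Ind_linear (gT : finGroupType) (J H A : {group gT}) (th : 'CF(H)) (phi : 'CF(A)) :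
    A \subset H -> H \subset J -> J \subset 'I[phi]%g -> 'Res[A] th = phi ->
  'Res[A] ('Ind[J] th) = #|J : H|%g%:R *: phi.
Proof.
move=> sAH sHJ sJI res_th; apply/cfun_inP=> a Aa; have sAJ := subset_trans sAH sHJ.
rewrite cfResE // cfunE cfIndE //.
rewrite (eq_bigr (fun=> phi a)) => [|y Jy].
  rewrite sumr_const -(Lagrange sHJ) -[phi a *+ _]mulr_natr natrM.
  by have H0 := neq0CG H; field; rewrite H0.
have Iy := subsetP sJI y Jy; have nAy := subsetP (norm_inertia phi) y Iy.
by rewrite -[RHS](inertia_valJ a Iy) -res_th cfResE // memJ_norm.
Qed.

(** * Counting Galois and group conjugates at an inertia group *)

Section Step.

Variable n : nat.
Hypothesis n_gt0 : (0 < n)%N.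
Local Notation nu := (nu n_gt0).
Local Notation gal_tr := (gal_tr n_gt0).
Local Notation gal_stab := (gal_stab n_gt0).
Variables (gT : finGroupType) (L A : {group gT}) (phi : 'CF(A)).
Hypotheses (Ln : (#|L| %| n)%N) (nAL : (A <| L)%g) (lin_phi : phi \is a linear_char).
Let I : {group gT} := 'I_L[phi]%G.

Let An : (#|A| %| n)%N.
Proof. exact: dvdn_trans (cardSg (normal_sub nAL)) Ln. Qed.
Let In : (#|I| %| n)%N.
Proof. exact: dvdn_trans (cardSg (Inertia_sub _ _)) Ln. Qed.
Let sAI : A \subset I. Proof. by rewrite sub_Inertia ?normal_sub. Qed.
Let irr_phi : phi \in irr A. Proof. exact: lin_char_irr. Qed.
Let nAx x : x \in L -> x \in 'N(A)%g. Proof. exact: (subsetP (normal_norm nAL)). Qed.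

(** [phi ^ x] has the same kernel as [phi]. Since Galois conjugation commutes with the action of
    [L], such an [x] also normalizes the inertia group. *)
Lemma norm_cfker_gal x : x \in 'N_L(cfker phi)%g -> exists k, (phi ^ x)%CF = cfAut (nu k) phi.
Proof.
case/setIP=> Lx nKx; apply: eq_cfker_lin_nu => //; first by rewrite cfConjg_lin_char.
by rewrite cfker_conjg ?nAx // (normP nKx).
Qed.

Lemma inertia_aut (u : {rmorphism algC -> algC}) : 'I_L[cfAut u phi]%g = I.
Proof.
by apply/setP=> y; rewrite !inE -cfAutConjg (inj_eq (@cfAut_inj u _ _)).
Qed.

Lemma norm_cfker_inertia x : x \in 'N_L(cfker phi)%g -> 'I_L[phi ^ x]%g = I.
Proof. by move=> nKx; have [k ->] := norm_cfker_gal nKx; apply: inertia_aut. Qed.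

Lemma norm_cfker_norm_inertia x : x \in 'N_L(cfker phi)%g -> x \in 'N(I)%g.
Proof.
move=> nKx; have /setIP[Lx _] := nKx.
by apply/normP; rewrite /= -[RHS](norm_cfker_inertia nKx) conjIg conjGid // conjg_inertia ?nAx.
Qed.

(* On A the Galois trace of chi is a multiple of the character gal_tr phi, whose kernel is cfker phi. *)
Lemma gal_tr_inv_norm_cfker (J : {group gT}) (chi : 'CF(J)) x :
    A \subset J -> chi \is a character -> chi != 0 -> 'Res[A] chi = chi 1%g *: phi ->
    x \in L -> (forall g, gal_tr chi (g ^ x)%g = gal_tr chi g) ->
  x \in 'N_L(cfker phi)%g.
Proof.
move=> sAJ Nchi nz_chi res_chi Lx inv_x; rewrite inE Lx /= inE.
have tr_chi a : a \in A -> gal_tr chi a = chi 1%g * gal_tr phi a.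
  move=> Aa; rewrite -(cfResE _ sAJ) // -gal_tr_Res res_chi !sum_cfunE mulr_sumr.
  apply: eq_bigr => k _; rewrite !cfunE rmorphM.
  by have /natrP[m ->] := Cnat_char1 Nchi; rewrite rmorph_nat.
have chi1 : chi 1%g != 0 by rewrite char1_eq0.
apply/subsetP=> _ /imsetP[a Ka ->]; rewrite -(cfker_gal_tr n_gt0 An irr_phi) in Ka *.
have Ntr : gal_tr phi \is a character by rewrite gal_tr_char ?lin_charW.
move: Ka; rewrite !cfkerEchar // !inE => /andP[Aa tr_a]; have Aax : (a ^ x)%g \in A by rewrite memJ_norm ?nAx.
rewrite Aax /=; apply/eqP/(mulfI chi1); rewrite -!tr_chi // inv_x tr_chi //.
by rewrite (eqP tr_a) tr_chi.
Qed.

Variable chi : 'CF(I).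
Hypotheses (irr_chi : chi \in irr I) (res_chi : 'Res[A] chi = chi 1%g *: phi).
Let psi := 'Ind[L] chi.
Let C := inv_conj (gal_tr chi) L.
Let Nchi : chi \is a character. Proof. exact: irrWchar. Qed.
Let chi1 : chi 1%g != 0. Proof. by have /irrP[i ->] := irr_chi; apply: irr1_neq0. Qed.

Let over_phi : '['Res[A] chi, phi] != 0.
Proof. by rewrite res_chi cfdotZl (irrWnorm irr_phi) mulr1. Qed.

Lemma step_Ind_irr : psi \in irr L.
Proof. exact: (inertia_Ind_irr nAL irr_phi (erefl _) irr_chi over_phi). Qed.

Lemma inv_conj_norm_cfker : C \subset 'N_L(cfker phi)%g.
Proof.
apply/subsetP=> x; rewrite inE => /andP[Lx /forallP inv_x].
apply: (gal_tr_inv_norm_cfker sAI Nchi _ res_chi Lx) => [|g]; last exact/eqP.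
by apply: contraNneq chi1 => ->; rewrite cfunE.
Qed.

(** Equal traces of irreducible characters mean Galois conjugacy; the first condition makes [x]
    normalize [I], so that [chi ^ x] is a true conjugate. *)
Lemma inv_conjP x :
  reflect (x \in 'N_L(cfker phi)%g /\ exists k, (chi ^ x)%CF = cfAut (nu k) chi) (x \in C).
Proof.
apply: (iffP idP) => [Cx | [nKx [k def_k]]].
  have nKx := subsetP inv_conj_norm_cfker x Cx; split=> //.
  apply: (gal_tr_inj In irr_chi); first exact: cfConjg_irr.
  rewrite gal_tr_conjg; apply/cfunP=> g; rewrite cfConjgE ?norm_cfker_norm_inertia //.
  move: Cx; rewrite inE => /andP[_ /forallP/(_ (g ^ x^-1)%g)/eqP <-].
  by rewrite conjgKV.
have /setIP[Lx _] := nKx; rewrite inE Lx; apply/forallP=> g; apply/eqP.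
by rewrite -{1}(gal_tr_aut n_gt0 In k Nchi) -def_k gal_tr_conjg cfConjgE ?conjgK ?norm_cfker_norm_inertia.
Qed.

Lemma sub_inertia_inv_conj : I \subset C.
Proof.
apply/subsetP=> x Ix; rewrite inE (subsetP (Inertia_sub _ _) x Ix).
by apply/forallP=> g; rewrite cfunJ.
Qed.

Lemma step_Ind_conjg x : x \in L -> x \in 'N(I)%g -> 'Ind[L] (chi ^ x)%CF = psi.
Proof. by move=> Lx nIx; rewrite -cfConjgInd_norm ?cfConjg_id ?(subsetP (normG L)). Qed.

(** Both [phi] and its k-th conjugate lie under [psi], so some [x] carries one to the other. Then
    [chi ^ x] and the k-th conjugate of [chi] lie over [phi ^ x] and both induce to [psi], hence
    coincide. *)
Lemma stab_psi_conjg k : cfAut (nu k) psi = psi ->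
  exists2 x, x \in C & (chi ^ x)%CF = cfAut (nu k) chi.
Proof.
move=> psi_k; have irr_psi := step_Ind_irr.
have psi_phi : '['Res[A] psi, phi] != 0.
  have [i def_chi] := irrP irr_chi; have [j def_psi] := irrP irr_psi.
  have [t def_phi] := irrP irr_phi.
  rewrite def_phi -irr_consttE def_psi.
  rewrite -(cfResRes _ sAI (Inertia_sub _ _)).
  apply: (@constt_Res_trans _ _ _ i); first by rewrite cfRes_char ?irr_char.
    by rewrite -constt_Ind_Res -def_chi -/psi irr_consttE def_psi cfdot_irr eqxx oner_eq0.
  by rewrite irr_consttE -def_chi -def_phi.
have irr_phik : cfAut (nu k) phi \in irr A by rewrite cfAut_irr.
have [|x Lx def_phik] := constt_Res_cfclass nAL irr_psi irr_phi irr_phik psi_phi.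
  by rewrite -psi_k -cfAutRes cfdot_aut_char ?irrWchar // fmorph_eq0.
have nKx : x \in 'N_L(cfker phi)%g.
  by rewrite inE Lx; apply/normP; rewrite -cfker_conjg ?nAx // -def_phik cfker_aut.
have nIx := norm_cfker_norm_inertia nKx.
have chi_xk : (chi ^ x)%CF = cfAut (nu k) chi.
  apply: (@inertia_Ind_inj _ L A I (phi ^ x)%CF nAL).
  - by rewrite cfConjg_irr.
  - by rewrite norm_cfker_inertia.
  - by rewrite cfConjg_irr.
  - by rewrite -cfConjgRes_norm ?nAx // cfConjg_iso.
  - by rewrite cfAut_irr.
  - by rewrite -cfAutRes -def_phik cfdot_aut_char ?irrWchar // fmorph_eq0.
  by rewrite step_Ind_conjg // -cfAutInd psi_k.
by exists x => //; apply/inv_conjP; split=> //; exists k.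
Qed.

(** The fibre is the coset of [I] through [x0]: an element fixing [chi] fixes its restriction, a
    nonzero multiple of [phi]. *)
Lemma card_inv_conj_fiber x0 : x0 \in C ->
  #|[set x in C | (chi ^ x)%CF == (chi ^ x0)%CF]| = #|I|.
Proof.
move=> Cx0; have nKC x : x \in C -> x \in 'N_L(cfker phi)%g by move/(subsetP inv_conj_norm_cfker).
have nIC x : x \in C -> x \in 'N(I)%g by move/nKC; apply: norm_cfker_norm_inertia.
have LC x : x \in C -> x \in L by rewrite inE => /andP[].
rewrite -[RHS](card_imset _ (mulIg x0)); apply: eq_card => x.
rewrite [LHS]inE; apply/andP/imsetP=> [[Cx /eqP eq_x] | [y Iy ->]].
  exists (x * x0^-1)%g; last by rewrite mulgKV.
  have nIxx : (x * x0^-1)%g \in 'N(I)%g by rewrite groupM ?groupV ?nIC.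
  have Lxx : (x * x0^-1)%g \in L by rewrite groupM ?groupV ?LC.
  have chi_xx : (chi ^ (x * x0^-1))%CF = chi.
    by rewrite cfConjgMnorm ?groupV ?nIC // eq_x cfConjgK.
  rewrite inE Lxx inE nAx //=; apply/eqP/(scalerI chi1).
  by rewrite -linearZ /= -res_chi cfConjgRes_norm ?nAx ?chi_xx.
have nIy : y \in 'N(I)%g by rewrite (subsetP (normG I)).
have eq_yx : (chi ^ (y * x0))%CF = (chi ^ x0)%CF.
  by rewrite cfConjgMnorm ?(nIC x0) // (cfConjg_id chi Iy).
split; last by rewrite eq_yx.
have /inv_conjP[nKx0 [k def_k]] := Cx0; apply/inv_conjP; split; last by exists k; rewrite eq_yx.
by rewrite groupM // nKC // (subsetP sub_inertia_inv_conj).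
Qed.

(* Double counting of the pairs (x, k) such that chi ^ x and the k-th Galois conjugate of chi agree. *)
Lemma card_inv_conj : (#|C| * gal_stab chi = #|I| * gal_stab psi)%N.
Proof.
pose S := [set k : {unit 'Z_n} | cfAut (nu k) psi == psi].
pose r x k := (chi ^ x)%CF == cfAut (nu k) chi.
transitivity (\sum_(x in C) \sum_(k in S) r x k)%N.
  rewrite -sum_nat_const; apply: eq_bigr => x Cx.
  have /inv_conjP[nKx [k0 def_k0]] := Cx; have /setIP[Lx _] := nKx.
  (* The units carrying [chi] to [chi ^ x] form a coset of its stabilizer, and all of them fix
     [psi], because [chi ^ x] induces to [psi] too. *)
  rewrite -(card_gal_fiber n_gt0 In k0 Nchi) -sum1dep_card big_mkcond [RHS]big_mkcond /=.
  apply: eq_bigr => k _; rewrite /r inE def_k0 [X in nat_of_bool X]eq_sym.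
  case: (cfAut (nu k) chi =P _) => [eq_k | _]; last by case: ifP.
  by rewrite cfAutInd eq_k -def_k0 step_Ind_conjg ?eqxx ?norm_cfker_norm_inertia.
(* Conversely, each unit fixing [psi] is matched by some [x0], hence by exactly [#|I|] elements of
   [C]. *)
rewrite exchange_big mulnC -sum_nat_const; apply: eq_bigr => k.
rewrite inE => /eqP/stab_psi_conjg[x0 Cx0 def_x0].
rewrite -(card_inv_conj_fiber Cx0) -sum1dep_card big_mkcondr.
by apply: eq_bigr => x _; rewrite /r def_x0; case: (_ == _).
Qed.

End Step.

(** * Paths in the graph of linear triples *)

Lemma lin_char_dot_eq (gT : finGroupType) (A : {group gT}) (phi psi : 'CF(A)) :
  phi \is a linear_char -> psi \is a linear_char -> '[phi, psi] != 0 -> phi = psi.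
Proof.
move=> /lin_char_irr/irrP[i ->] /lin_char_irr/irrP[j ->].
by rewrite cfdot_irr pnatr_eq0 eqb0 negbK => /eqP->.
Qed.

Section Children.

Variables (gT : finGroupType) (G N : {group gT}) (Asel : triple gT -> {group gT})
  (Rep : forall t : triple gT, seq 'CF(Asel t)).
Hypothesis spec : choice_spec G N Rep.

Lemma invariant_commg_cfker (H A : {group gT}) (th : 'CF(A)) :
    (A <| H)%g -> th \is a linear_char ->
    (forall h g, h \in H -> th (g ^ h^-1)%g = th g) ->
  ([~: A, H] \subset cfker th)%g.
Proof.
move=> nAH lin_th inv_th; rewrite gen_subG; apply/subsetP=> _ /imset2P[a h Aa Hh ->].
have nAh : h \in 'N(A)%g := subsetP (normal_norm nAH) h Hh.
have Aah : (a ^ h)%g \in A by rewrite memJ_norm.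
rewrite /= cfkerEchar ?lin_charW // inE commgEl groupM ?groupV //= lin_char1 //.
rewrite lin_charM ?groupV // -(inv_th _ (a ^ h)%g Hh) conjgK -lin_charM ?groupV //.
by rewrite mulVg lin_char1.
Qed.

(** [tA t] is central modulo the kernel, so joining it to [Asel t] keeps the quotient abelian;
    maximality of the order then forces inclusion. *)
Lemma sub_Asel t : NLinTriple G N t -> tA t \subset Asel t.
Proof.
move=> Nt; have [sHG nAH lin_th inv_th _] := Nt; have [[nSH sKS abS maxS] _] := spec Nt.
set K := cfker (tth t) in sKS abS maxS.
have sAHK := invariant_commg_cfker nAH lin_th inv_th.
have sKA : K \subset tA t := cfker_sub _.
have nKH : tH t \subset 'N(K)%g.
  rewrite -commg_subr (subset_trans _ sAHK) // commGC commSg //.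
have nBH : (Asel t <*> tA t <| tH t)%g by rewrite normalY.
have sKB : K \subset (Asel t <*> tA t)%g by rewrite (subset_trans sKS) ?joing_subl.
have [nKS nKA] := (subset_trans (normal_sub nSH) nKH, subset_trans (normal_sub nAH) nKH).
have abB : abelian (Asel t <*> tA t / K)%g.
  rewrite quotientY // abelianY abS /=; apply/andP; split.
    apply: sub_der1_abelian; apply: subset_trans sAHK.
    by rewrite /derived_at commgS // normal_sub.
  by rewrite quotient_cents2 // (subset_trans _ sAHK) // commgS // normal_sub.
have := maxS (Asel t <*> tA t)%G nBH sKB abB; rewrite leqNgt => leB.
have : (Asel t <*> tA t)%g \subset Asel t.
  apply: contraNT leB => not_sub; apply: proper_card.
  by rewrite /proper joing_subl.
exact: subset_trans (joing_subr _ _).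
Qed.

Lemma in_Cl_child t t' : NLinTriple G N t -> in_Cl Rep t t' ->
  [/\ NLinTriple G N t', (tA t' <| tH t)%g, tA t \subset tA t',
      tH t' = 'I_(tH t)[tth t']%G & 'Res[tA t] (tth t') = tth t].
Proof.
move=> Nt [_ [phi Rphi ->]]; have [sHG nAH lin_th _ _] := Nt.
have [[nSH _ _ _] [Lin _ _]] := spec Nt; have [lin_phi over ker_phi] := Lin phi Rphi.
have sAS := sub_Asel Nt; have sSH := normal_sub nSH.
split=> //=; last by apply: lin_char_dot_eq; rewrite ?cfRes_lin_char.
split=> //=; first exact: subset_trans (Inertia_sub _ _) sHG.
  by rewrite normal_Inertia.
by move=> h g /setIP[_ Ih]; apply: inertia_valJ; rewrite groupV.
Qed.

Local Notation n_gt0 := (cardG_gt0 G).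
Local Notation gal_tr := (gal_tr n_gt0).
Local Notation gal_stab := (gal_stab n_gt0).

Lemma leaf_step t t' (H : {group gT}) (th : 'CF(H)) (C := inv_conj (gal_tr ('Ind[tH t'] th)) (tH t)) :
    NLinTriple G N t -> in_Cl Rep t t' -> tA t' \subset H -> H \subset tH t' ->
    th \is a linear_char -> 'Res[tA t'] th = tth t' -> 'Ind[tH t'] th \in irr (tH t') ->
  [/\ 'Ind[tH t] th \in irr (tH t), tH t' \subset C,
      (#|C| * gal_stab ('Ind[tH t'] th) = #|tH t'| * gal_stab ('Ind[tH t] th))%N,
      inv_conj (gal_tr th) (tH t) \subset C &
      (forall x, x \in 'N_(tH t)(cfker (tth t'))%g -> exists u : {rmorphism algC -> algC},
         forall g, 'Ind[tH t'] th (g ^ x^-1)%g = u ('Ind[tH t'] th g)) ->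
      'N_(tH t)(cfker (tth t'))%g = C].
Proof.
move=> Nt Clt sAH sHI lin_th res_th irr_chi.
have [_ nAL _ defI _] := in_Cl_child Nt Clt; have [sLG _ _ _ _] := Nt.
have [Nt' _ _ _ _] := in_Cl_child Nt Clt; have [_ _ lin_phi _ _] := Nt'.
have Ln : (#|tH t| %| #|G|)%N := cardSg sLG.
have sIL : tH t' \subset tH t by rewrite defI Inertia_sub.
rewrite -(cfIndInd th sIL sHI).
have sII : tH t' \subset 'I[tth t']%g by rewrite defI subsetIr.
have res_chi : 'Res[tA t'] ('Ind[tH t'] th) = 'Ind[tH t'] th 1%g *: tth t'.
  by rewrite (cfRes_Ind_linear sAH sHI sII res_th) cfInd1 // lin_char1 // mulr1.
(* The types of the characters mention [tH t'], so it is made a variable before being replaced by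
   the inertia group. *)
move: (tH t') defI @C sHI irr_chi sIL sII res_chi => I defI; subst I.
move=> C sHI irr_chi sIL sII res_chi.
have CN := inv_conj_norm_cfker n_gt0 Ln nAL lin_phi irr_chi res_chi.
have CP := inv_conjP n_gt0 Ln nAL lin_phi irr_chi res_chi.
have norm_I := norm_cfker_norm_inertia n_gt0 Ln nAL lin_phi.
split.
- exact: (step_Ind_irr nAL lin_phi irr_chi res_chi).
- exact: sub_inertia_inv_conj.
- exact: (card_inv_conj n_gt0 Ln nAL lin_phi irr_chi res_chi).
- apply/subsetP=> x; rewrite inE => /andP[Lx /forallP inv_x].
  (* Invariance of the trace of [th] already makes [x] normalize the kernel below, hence the inertia
     group; conjugation by [x] then permutes the terms of the induction formula. *)
  have nKx : x \in 'N_(tH t)(cfker (tth t'))%g.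
    apply: (@gal_tr_inv_norm_cfker _ n_gt0 _ _ _ _ Ln nAL lin_phi H th) => //.
    + exact: lin_charW.
    + by rewrite -char1_eq0 ?lin_charW // lin_char1 ?oner_eq0.
    + by rewrite lin_char1 // scale1r.
    by move=> g; apply/eqP.
  rewrite inE Lx; apply/forallP=> g; apply/eqP.
  rewrite gal_tr_Ind !cfIndE //; congr (_ * _).
  rewrite (reindex_inj (conjg_inj x)) /=; apply: eq_big => y; first by rewrite memJ_norm ?norm_I.
  by rewrite -conjgM -conjgC conjgM (eqP (inv_x _)).
move=> good; apply/eqP; rewrite eqEsubset CN andbT; apply/subsetP=> x nKx.
apply/CP; split=> //; have [u eq_u] := good x nKx; have [k kE] := rmorphism_nu n_gt0 u.
exists k; rewrite -kE ?irrWchar //; last by apply: dvdn_trans Ln; apply: cardSg sIL.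
by apply/cfunP=> g; rewrite cfConjgE ?norm_I // cfunE eq_u.
Qed.

End Children.

Lemma nondecreasing_chain_eq (f : nat -> rat) (b : nat) :
    (forall i, (1 <= i < b)%N -> f i <= f i.+1) ->
  (1 <= b)%N -> f 1%N = f b <-> forall i, (1 <= i < b)%N -> f i = f i.+1.
Proof.
elim: b => // -[_ _ _ | b IHb leF _]; first by split=> // _ i; case: i.
have leF' i : (1 <= i < b.+1)%N -> f i <= f i.+1.
  by case/andP=> i1 ib; apply: leF; rewrite i1 ltnW.
have le1b : f 1%N <= f b.+1.
  elim: (b) leF' => // c IHc leF'; apply: le_trans (leF' c.+1 _); last by rewrite ltnSn.
  by apply: IHc => i /andP[i1 ic]; apply: leF'; rewrite i1 ltnW.
have leb : f b.+1 <= f b.+2 by apply: leF; rewrite ltnSn.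
have IH := IHb leF' isT; split=> [eq1 i | eqF].
  have eqb : f b.+1 = f b.+2 by apply/eqP; rewrite eq_le leb -eq1.
  case/andP=> i1; rewrite ltnS leq_eqVlt => /orP[/eqP-> // | ib].
  by apply: (proj1 IH); rewrite ?i1 // eq1 eqb.
rewrite -(eqF b.+1) ?ltnSn //; apply: (proj2 IH) => i /andP[i1 ib].
by apply: eqF; rewrite i1 ltnW.
Qed.

(** * Characters and centralizers along the path of a leaf *)

Section LeafPath.

Variables (gT : finGroupType) (G N : {group gT}) (Asel : triple gT -> {group gT})
  (Rep : forall t : triple gT, seq 'CF(Asel t)) (p : seq (triple gT)).
Hypotheses (nNG : (N <| G)%g) (spec : choice_spec G N Rep) (leaf : leaf_path G N Rep p).

Local Notation t := (nth (root_triple G N) p).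
Let v := last (root_triple G N) p.
Local Notation H := (tA v).
Local Notation th := (tth v).
(** Indices of [t] start at 0: [t i] is the node i+1, and the leaf is [t m]. *)
Let m := (size p).-1.

Let t0 : t 0 = root_triple G N. Proof. by have [[]] := leaf. Qed.
Let p_gt0 : (0 < size p)%N. Proof. by have [[]] := leaf. Qed.
Let size_p : size p = m.+1. Proof. by rewrite prednK. Qed.
Let tm : t m = v. Proof. exact: nth_last. Qed.
Let edge i : (i < m)%N -> in_Cl Rep (t i) (t i.+1).
Proof. by move=> im; have [[_ _ e] _] := leaf; apply: e; rewrite size_p ltnS. Qed.
Let leafH : tH v = H. Proof. by case: leaf. Qed.

Lemma node_NLinTriple i : (i <= m)%N -> NLinTriple G N (t i).
Proof.
elim: i => [_ | i IHi im]; last by have [] := in_Cl_child spec (IHi (ltnW im)) (edge im).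
rewrite t0; split=> //=; first exact: rpred1.
- by move=> h g Gh; rewrite !cfun1E memJ_norm ?groupV // (subsetP (normal_norm nNG)).
(* The kernel of the permutation character on the cosets of [N] is the core of [N], which is [N] by
   normality. *)
rewrite cfker_Ind ?cfun1_char ?oner_neq0 ?normal_sub // cfker_cfun1.
by apply/eqP; rewrite eqEsubset gcore_sub gcore_max ?normal_norm.
Qed.

Lemma node_leaf i : (i <= m)%N ->
  [/\ tA (t i) \subset H, 'Res[tA (t i)] th = tth (t i) & H \subset tH (t i)].
Proof.
(* Induction on the distance [m - i] to the leaf. *)
move=> im; rewrite -(subKn im); have := leq_subr i m; move: (m - i)%N => d.
elim: d => [_ | d IHd dm]; first by rewrite subn0 tm leafH cfRes_id.
have [sAH resA sHI] := IHd (ltnW dm); have ltm : (m - d.+1 < m)%N by rewrite ltn_subrL (leq_ltn_trans _ dm).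
have := in_Cl_child spec (node_NLinTriple (ltnW ltm)) (edge ltm).
rewrite -subSn // subSS => -[_ _ sAA defI resAA].
have sIL : tH (t (m - d)) \subset tH (t (m - d.+1)) by rewrite defI Inertia_sub.
split; [exact: subset_trans sAH | | exact: subset_trans sIL].
by rewrite -resAA -resA cfResRes.
Qed.

Lemma lin_leaf : th \is a linear_char.
Proof. by have := node_NLinTriple (leqnn m); rewrite tm; case. Qed.

Local Notation gal_tr := (gal_tr (cardG_gt0 G)).
Local Notation gal_stab := (gal_stab (cardG_gt0 G)).
Local Notation chi i := ('Ind[tH (t i)] th).

Lemma node_step i (C := inv_conj (gal_tr (chi i.+1)) (tH (t i))) : (i < m)%N ->
    chi i.+1 \in irr (tH (t i.+1)) ->
  [/\ chi i \in irr (tH (t i)), tH (t i.+1) \subset C,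
      (#|C| * gal_stab (chi i.+1) = #|tH (t i.+1)| * gal_stab (chi i))%N,
      inv_conj (gal_tr th) (tH (t i)) \subset C &
      (forall x, x \in 'N_(tH (t i))(cfker (tth (t i.+1)))%g ->
         exists u : {rmorphism algC -> algC},
           forall g, chi i.+1 (g ^ x^-1)%g = u (chi i.+1 g)) ->
      'N_(tH (t i))(cfker (tth (t i.+1)))%g = C].
Proof.
move=> im irr_chi; have [sAH resA sHI] := node_leaf im.
exact: (leaf_step spec (node_NLinTriple (ltnW im)) (edge im) sAH sHI lin_leaf resA irr_chi).
Qed.

(** [tH v] and [H] agree only propositionally; a variable [J] lets the trivial induction be removed
    by substitution. *)
Lemma leaf_Ind_id (J : {group gT}) : J = H ->
  [/\ 'Ind[J] th \in irr J, gal_stab ('Ind[J] th) = gal_stab th &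
      forall X, inv_conj (gal_tr ('Ind[J] th)) X = inv_conj (gal_tr th) X].
Proof. by move=> ->; rewrite cfInd_id lin_char_irr ?lin_leaf. Qed.

Lemma node_Ind_irr i : (i <= m)%N -> chi i \in irr (tH (t i)).
Proof.
move=> im; rewrite -(subKn im); have := leq_subr i m; move: (m - i)%N => d.
elim: d => [_ | d IHd dm]; first by rewrite subn0 tm; have [] := leaf_Ind_id leafH.
have ltm : (m - d.+1 < m)%N by rewrite ltn_subrL (leq_ltn_trans _ dm).
have := node_step ltm; rewrite -subSn // subSS => /(_ (IHd (ltnW dm))).
by case.
Qed.

Local Notation K := (cfker th)%G.
Local Notation Cen i := (CenQ_group (tH (t i)) (epsQ H K)).

Let alpha := alphaQ G H K.

Let sub_nodes i : (i < m)%N -> tH (t i.+1) \subset tH (t i).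
Proof.
move=> im; have [_ _ _ -> _] := in_Cl_child spec (node_NLinTriple (ltnW im)) (edge im).
exact: Inertia_sub.
Qed.

Let node_dvd i : (i <= m)%N -> (#|tH (t i)| %| #|G|)%N.
Proof. by move=> /node_NLinTriple[sG _ _ _ _]; apply: cardSg. Qed.

Let Hdvd : (#|H| %| #|G|)%N.
Proof. by rewrite -leafH -tm node_dvd. Qed.

Let nz_stab i : (i <= m)%N -> (gal_stab (chi i))%:R != 0 :> rat.
Proof.
move=> im; rewrite pnatr_eq0 -lt0n gal_stab_gt0 ?node_dvd //.
exact/irrWchar/node_Ind_irr.
Qed.

Let nz_card (J : {group gT}) : #|J|%:R != 0 :> rat.
Proof. by rewrite pnatr_eq0 -lt0n. Qed.

Lemma CenQ_node i : (i < m)%N ->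
  CenQ (tH (t i)) (eQ (tH (t i.+1)) H K) = inv_conj (gal_tr (chi i.+1)) (tH (t i)).
Proof. by move=> im; have [_ _ sHI] := node_leaf im; apply: CenQ_eQ => //; apply: lin_leaf. Qed.

Lemma CenQ_node_group i : (i < m)%N ->
  exists2 C : {group gT}, CenQ (tH (t i)) (eQ (tH (t i.+1)) H K) = C &
    [/\ tH (t i.+1) \subset C, Cen i \subset C &
        (#|C| * gal_stab (chi i.+1) = #|tH (t i.+1)| * gal_stab (chi i))%N].
Proof.
move=> im; exists (CenQ_group (tH (t i)) (eQ (tH (t i.+1)) H K)) => //.
rewrite /= (CenQ_node im) (CenQ_epsQ (cardG_gt0 G) Hdvd lin_leaf).
by have [] := node_step im (node_Ind_irr im).
Qed.

Lemma alpha_gal_stab : alpha =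
  #|Cen 0|%:R * (gal_stab (chi m))%:R / (#|tH (t m)|%:R * (gal_stab (chi 0%N))%:R).
Proof.
have GE : tH (t 0) = G by rewrite t0.
have [_ _ sHG] := node_leaf (leq0n m); have irr0 := node_Ind_irr (leq0n m).
have [_ stab_m _] := leaf_Ind_id leafH.
rewrite /alpha -[X in alphaQ X]GE.
rewrite (alphaQ_gal_stab (cardG_gt0 G) Hdvd lin_leaf sHG (node_dvd (leq0n m)) irr0).
by rewrite tm stab_m leafH !natrM.
Qed.

(** At the last step the induced character is [th] itself, so the invariance group is the
    centralizer of epsilon. *)
Lemma leaf_Cen : (0 < m)%N ->
  (#|Cen m.-1| * gal_stab (chi m) = #|tH (t m)| * gal_stab (chi m.-1))%N.
Proof.
move=> m_gt0; have im : (m.-1 < m)%N by rewrite prednK.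
have [_ _ ] := node_step im (node_Ind_irr im); rewrite prednK // => card_m _ _.
rewrite -card_m tm; have [_ _ ->] := leaf_Ind_id leafH.
by rewrite -(CenQ_epsQ (cardG_gt0 G) Hdvd lin_leaf).
Qed.

Let ratio i : rat := #|Cen i|%:R / (gal_stab (chi i))%:R.

(** The product set of [Cen i] and [tH (t i.+1)] lies in [C], and its size is known since the two
    factors meet in [Cen i.+1]. The ratios compare this subset with [C]. *)
Lemma Cen_ratio i : (i < m)%N ->
  ratio i <= ratio i.+1 /\
  (CenQ (tH (t i)) (eQ (tH (t i.+1)) H K) = (Cen i * tH (t i.+1))%g <-> ratio i = ratio i.+1).
Proof.
move=> im; have [C -> [sIC sCC cardC]] := CenQ_node_group im.
have nz1 := nz_stab (ltnW im); have nz2 := nz_stab im.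
have defI : (Cen i :&: tH (t i.+1))%g = Cen i.+1.
  apply/setP=> x; rewrite !inE andbAC [X in X && _]andbC; congr (_ && _).
  by case: (boolP (x \in tH (t i.+1))) => // /(subsetP (sub_nodes im))->.
have cardM := mul_cardG (Cen i) (tH (t i.+1)); rewrite defI in cardM.
have sMC : (Cen i * tH (t i.+1))%g \subset C by rewrite mul_subG.
(* Multiplying by this factor turns the ratios into the sizes of the product set and of [C], times
   one common positive integer. *)
have scale : (0 : rat) < #|tH (t i.+1)|%:R * (gal_stab (chi i))%:R * (gal_stab (chi i.+1))%:R.
  by rewrite !mulr_gt0 // lt_neqAle eq_sym ?nz_card ?nz1 ?nz2 ler0n.
have scale1 : ratio i * (#|tH (t i.+1)|%:R * (gal_stab (chi i))%:R * (gal_stab (chi i.+1))%:R)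
    = (#|(Cen i * tH (t i.+1))%g| * (#|Cen i.+1| * gal_stab (chi i.+1)))%N%:R.
  by rewrite mulnA -cardM !natrM /ratio; field; rewrite nz1.
have scale2 : ratio i.+1 * (#|tH (t i.+1)|%:R * (gal_stab (chi i))%:R * (gal_stab (chi i.+1))%:R)
    = (#|C| * (#|Cen i.+1| * gal_stab (chi i.+1)))%N%:R.
  by rewrite mulnCA cardC !natrM /ratio; field; rewrite nz2.
have pos : (0 < #|Cen i.+1| * gal_stab (chi i.+1))%N.
  by rewrite muln_gt0 cardG_gt0 lt0n -(pnatr_eq0 rat).
split; first by rewrite -(ler_pM2r scale) scale1 scale2 ler_nat leq_mul2r subset_leq_card ?orbT.
split=> [defC | eqr]; first by apply: (mulIf (lt0r_neq0 scale)); rewrite scale1 scale2 defC.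
apply/esym/eqP; rewrite eqEcard sMC -(leq_pmul2r pos) -(ler_nat rat) -scale1 -scale2 eqr.
exact: lexx.
Qed.

Lemma alpha_ratio : (0 < m)%N -> alpha = ratio 0 / ratio m.-1.
Proof.
move=> m_gt0; rewrite alpha_gal_stab /ratio.
have := congr1 (fun k : nat => k%:R : rat) (leaf_Cen m_gt0); rewrite /= !natrM => eq_m.
have [nz0 nzm1] := (nz_stab (leq0n m), nz_stab (leq_pred m)).
have nzC := nz_card (Cen m.-1); have nzH := nz_card (tH (t m)).
have -> : (gal_stab (chi m))%:R = #|tH (t m)|%:R * (gal_stab (chi m.-1))%:R / #|Cen m.-1|%:R :> rat.
  by rewrite -eq_m mulrC mulKf.
by field; rewrite nz0 nzm1 nzC nzH.
Qed.

(** There is no last step here: [th] is a linear character of [G], so epsilon is centralized by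
    [G]. *)
Lemma alpha_height1 : m = 0%N -> alpha = 1.
Proof.
move=> m0; have HG : H = G by rewrite -leafH -tm m0 t0.
have tm0 : t m = t 0 by rewrite m0.
rewrite alpha_gal_stab tm0.
have -> : #|Cen 0| = #|tH (t 0)|.
  rewrite /= (CenQ_epsQ (cardG_gt0 G) Hdvd lin_leaf); apply: eq_card => x; rewrite inE t0 /=.
  case: (boolP (x \in G)) => //= Gx; apply/forallP=> g; rewrite cfunJ //.
  by rewrite HG.
by rewrite mulfV // mulf_neq0 ?nz_card ?nz_stab.
Qed.

Let Hn i : {group gT} := tH (node G N p i).
Let idx (A B : {set gT}) : rat := (#|A : B|%g)%:R.

(** [C] is any family agreeing with the centralizers on the range, so that normalizers can be
    substituted on a good leaf. *)
Lemma alpha_formula (C : nat -> {set gT}) :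
    (forall i, (2 <= i <= m)%N -> C i = CenQ (Hn i.-1) (eQ (Hn i) H K)) ->
  alpha = idx (CenQ G (epsQ H K)) (CenQ (Hn m) (epsQ H K)) / \prod_(2 <= i < m.+1) idx (C i) (Hn i).
Proof.
move=> defC; have GE : tH (t 0) = G by rewrite t0.
rewrite -[X in CenQ (gval X)]GE /Hn /node.
(* In height one, node 0 is read as node 1, so the index is that of a group in itself and the
   product is empty. *)
case: (posnP m) => [m0 | m_gt0].
  rewrite big_geq ?m0 // divr1 /idx indexgg alpha_height1 //.
have sCen i : (i <= m)%N -> Cen i \subset Cen 0.
  elim: i => // i IHi im; apply: subset_trans (IHi (ltnW im)).
  by apply/subsetP=> x; rewrite !inE => /andP[/(subsetP (sub_nodes im))-> ->].
have idxC : idx (CenQ (tH (t 0)) (epsQ H K)) (CenQ (tH (t m.-1)) (epsQ H K)) =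
    #|Cen 0|%:R / #|Cen m.-1|%:R.
  by rewrite /idx -natf_indexg // sCen ?leq_pred.
have nzm1 := nz_stab (leq_pred m); have nz0 := nz_stab (leq0n m).
(* Each factor is a quotient of consecutive stabilizer orders, by the counting identity of the
   Clifford step. *)
have prodE : \prod_(2 <= i < m.+1) idx (C i) (tH (t i.-1)) =
    (gal_stab (chi 0%N))%:R / (gal_stab (chi m.-1))%:R.
  have [m1 | m_gt1] := leqP m 1.
    have -> : m = 1%N by apply/eqP; rewrite eqn_leq m1.
    by rewrite big_geq // divff // nz_stab.
  rewrite (telescope_prodr_eq (fun i => (gal_stab (chi i.-2))%:R)) //.
  - by move=> i bi; rewrite unitfE nz_stab //; lia.
  case=> [|[|i]] // /andP[_ im]; rewrite defC //=.
  have [D defD [sID _ cardD]] := CenQ_node_group (ltnW im : i < m)%N.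
  rewrite /idx /Hn /node /= defD natf_indexg //.
  apply/eqP; rewrite eqr_div ?nz_card ?nz_stab //; last exact: ltnW.
  by rewrite -!natrM cardD mulnC.
rewrite idxC prodE alpha_ratio // /ratio.
by have nzC := nz_card (Cen m.-1); field; rewrite nz0 nzm1 nzC.
Qed.

Lemma alpha_eq1 (C : nat -> {set gT}) :
    (forall i, (2 <= i <= m)%N -> C i = CenQ (Hn i.-1) (eQ (Hn i) H K)) ->
  alpha = 1 <-> forall i, (2 <= i <= m)%N -> C i = (CenQ (Hn i.-1) (epsQ H K) * Hn i)%g.
Proof.
move=> defC; case: (posnP m) => [m0 | m_gt0].
  split=> [_ [|[|i]] | _]; rewrite ?m0 ?andbF //; exact: alpha_height1.
(* The chain is [ratio] shifted by one and stops at [m.-1]: the step into the leaf was already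
   absorbed by [leaf_Cen]. *)
have leR i : (1 <= i < m)%N -> ratio i.-1 <= ratio i.+1.-1.
  by case: i => // i im; have [] := Cen_ratio (ltnW im).
have chain := nondecreasing_chain_eq leR m_gt0.
have nzr : ratio m.-1 != 0.
  by rewrite /ratio mulf_neq0 ?invr_eq0 ?nz_card ?nz_stab ?leq_pred.
have -> : (alpha = 1) <-> (ratio 0 = ratio m.-1).
  rewrite alpha_ratio //; split=> [eq1 | ->]; last exact: divff.
  by rewrite -[LHS](divfK nzr) eq1 mul1r.
split=> [/chain eqR [|[|i]] // im | eqC]; first last.
  apply/chain=> -[|i] // im; have [_ <-] := Cen_ratio (ltnW im).
  by rewrite -(eqC i.+2) // defC.
rewrite defC //; have [_ E] := Cen_ratio (ltnW im : i < m)%N.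
exact: (proj2 E (eqR i.+1 im)).
Qed.

Lemma good_node_cfker i : good_leaf G N p -> (2 <= i <= m)%N ->
  ('N_(Hn i.-1)(cfker (tth (node G N p i))))%g = CenQ (Hn i.-1) (eQ (Hn i) H K).
Proof.
case: i => [|[|i]] // good im; have ltim : (i < m)%N by apply: ltnW.
rewrite /Hn /node /= CenQ_node //.
have [_ _ _ _ ->] := node_step ltim (node_Ind_irr ltim) => // x nKx.
by apply: (good i.+2) nKx; rewrite size_p; apply: leqW.
Qed.

End LeafPath.

Theorem theorem4 (gT : finGroupType) (G N : {group gT})
  (Asel : triple gT -> {group gT}) (Rep : forall t : triple gT, seq 'CF(Asel t))
  (p : seq (triple gT)) :
  classC G -> (N <| G)%g -> choice_spec G N Rep -> leaf_path G N Rep p ->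
  let n := size p in
  let Hn (i : nat) : {group gT} := tH (node G N p i) in
  let v := last (root_triple G N) p in
  let H : {group gT} := tA v in
  let K : {group gT} := (cfker (tth v))%G in
  let eps := epsQ H K in
  let alpha := alphaQ G H K in
  let idx (A B : {set gT}) : rat := (#|A : B|%g)%:R in
  let formula (C : nat -> {set gT}) : rat :=
    idx (CenQ G eps) (CenQ (Hn n.-1) eps) / \prod_(2 <= i < n) idx (C i) (Hn i) in
  let cond (C : nat -> {set gT}) : Prop :=
    forall i : nat, (2 <= i <= n.-1)%N -> C i = (CenQ (Hn i.-1) eps * Hn i)%g in
  let CenE (i : nat) : {set gT} := CenQ (Hn i.-1) (eQ (Hn i) H K) in
  let NKer (i : nat) : {set gT} := ('N_(Hn i.-1)(cfker (tth (node G N p i))))%g in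
  [/\ alpha = formula CenE,
      alpha = 1 <-> cond CenE &
      good_leaf G N p -> alpha = formula NKer /\ (alpha = 1 <-> cond NKer)].
Proof.
move=> _ nNG spec leaf n Hn v H K eps alpha idx formula cond CenE NKer.
have n_gt0 : (0 < n)%N by have [[]] := leaf.
have form C : (forall i, (2 <= i <= n.-1)%N -> C i = CenE i) -> alpha = formula C.
  by move=> defC; rewrite /formula -(prednK n_gt0); apply: (alpha_formula nNG spec leaf).
split; [exact: form | exact: (alpha_eq1 nNG spec leaf) |] => good.
have defN i : (2 <= i <= n.-1)%N -> NKer i = CenE i by apply: (good_node_cfker nNG spec leaf).
by split; [exact: form | exact: (alpha_eq1 nNG spec leaf)].
Qed.
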